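(* For every $n\ge 1$, \[|R^s_n(\top)|=|I_n(010,101,120,201)|=|I_n(010,110,120,210)|=|I_n(010,100,120,210)|,\] where $R^s_n(\top)$ is the set of strong rectangulations of size $n$ in which every vertical segment has its upper endpoint on the top side of the bounding rectangle.
   Context: A rectangulation of an axis-aligned rectangle $R$ is a decomposition of $R$ into finitely many interior-disjoint axis-aligned rectangles; its size is the number of rectangles. A segment is a maximal straight line segment which is a union of sides of rectangles and is not contained in the boundary of $R$; rectangulations are generic (no two segments cross; segments only meet in T-shaped joints). For rectangles $X,Y$: $Y$ is right of $X$ if there is a sequence $X=X_1,\dots,X_k=Y$ such that for every $i$ there is a vertical segment containing the right side of $X_i$ and the left side of $X_{i+1}$; $Y$ is above $X$ analogously with horizontal segments. Two rectangulations are strongly equivalent if there is a bijection between their rectangles preserving the left–right and above–below relations and also preserving contacts, i.e. which pairs of rectangles have boundaries sharing a segment of positive length. A strong rectangulation is a strong equivalence class. An inversion sequence of length $n$ is an integer sequence $e=(e_1,\dots,e_n)$ with $0\le e_j\le j-1$ for all $j$; $I_n$ denotes the set of them. A pattern is a sequence $f=(f_1,\dots,f_m)$ of nonnegative integers (written without commas); $e$ contains $f$ if there are indices $i_1<\dots<i_m$ such that for all $a,b$, $e_{i_a}<e_{i_b}$ iff $f_a<f_b$ and $e_{i_a}=e_{i_b}$ iff $f_a=f_b$; otherwise $e$ avoids $f$. $I_n(T)$ is the set of inversion sequences of length $n$ avoiding every pattern in $T$. *)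

(* Defs.v *)
From HB Require Import structures.
From mathcomp Require Import all_boot all_order all_algebra.
From mathcomp Require Import all_classical all_reals.
From mathcomp Require Import topology normedtype.
From Stdlib Require Import Relation_Operators.

Set Implicit Arguments.
Unset Strict Implicit.
Unset Printing Implicit Defensive.

Import Order.TTheory GRing.Theory Num.Theory.
Import numFieldNormedType.Exports.

Local Open Scope classical_set_scope.
Local Open Scope ring_scope.

Section Plane.
Context {R : realType}.

Definition vseg (x y0 y1 : R) : set (R * R) := [set x] `*` `[y0, y1].
Definition hseg (y x0 x1 : R) : set (R * R) := `[x0, x1] `*` [set y].

End Plane.

Record rect (R : realType) := Rect {
  xmin : R;
  xmax : R;
  ymin : R;
  ymax : R;
  xmin_lt_xmax : xmin < xmax;
  ymin_lt_ymax : ymin < ymax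
}.

Section Rectangles.
Context {R : realType}.
Implicit Types r : rect R.

Definition region r : set (R * R) :=
  `[xmin r, xmax r] `*` `[ymin r, ymax r].

Definition left_side r := vseg (xmin r) (ymin r) (ymax r).
Definition right_side r := vseg (xmax r) (ymin r) (ymax r).
Definition bottom_side r := hseg (ymin r) (xmin r) (xmax r).
Definition top_side r := hseg (ymax r) (xmin r) (xmax r).

Definition sides r : set (set (R * R)) :=
  [set S | [\/ S = left_side r, S = right_side r, S = bottom_side r
             | S = top_side r]].

Definition perimeter r : set (R * R) := \bigcup_(S in sides r) S.

(* A segment of positive length lying on the perimeter of an axis-aligned
   rectangle is necessarily vertical or horizontal. *)
Definition contact r1 r2 : Prop :=
  exists a b c : R, b < c /\
    (vseg a b c `<=` perimeter r1 `&` perimeter r2 \/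
     hseg a b c `<=` perimeter r1 `&` perimeter r2).

End Rectangles.

(* The rectangles carry labels in 'I_n.  The labelling is immaterial: strong
   equivalence below quantifies over all bijections between the labels. *)
Record decomposition (R : realType) (n : nat) := Decomposition {
  box : rect R;
  tile : 'I_n -> rect R;
  tile_cover : \bigcup_i region (tile i) = region box;
  tile_disjoint : forall i j, i != j ->
    (region (tile i))° `&` (region (tile j))° = set0
}.

Section Segments.
Context {R : realType} {n : nat}.
Implicit Types (d : decomposition R n) (i j : 'I_n).

Definition union_of_sides d (S : set (R * R)) : Prop :=
  exists2 F : set (set (R * R)),
    F `<=` \bigcup_i sides (tile d i) & S = \bigcup_(s in F) s.

(* Maximality only has to be tested against segments of the same direction: a
   straight line segment containing a vertical one of positive length is
   vertical.  Likewise, a non-degenerate segment that is a union of sides is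
   vertical or horizontal. *)
Definition vertical_segment d (x y0 y1 : R) : Prop :=
  [/\ y0 < y1,
      union_of_sides d (vseg x y0 y1),
      (forall z0 z1, union_of_sides d (vseg x z0 z1) ->
         vseg x y0 y1 `<=` vseg x z0 z1 -> vseg x z0 z1 = vseg x y0 y1)
    & ~ (vseg x y0 y1 `<=` perimeter (box d))].

Definition horizontal_segment d (y x0 x1 : R) : Prop :=
  [/\ x0 < x1,
      union_of_sides d (hseg y x0 x1),
      (forall z0 z1, union_of_sides d (hseg y z0 z1) ->
         hseg y x0 x1 `<=` hseg y z0 z1 -> hseg y z0 z1 = hseg y x0 x1)
    & ~ (hseg y x0 x1 `<=` perimeter (box d))].

(* No two segments cross, i.e. share a point that is not an endpoint of either
   of them.  Four tiles around a common point are excluded: by maximality, that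
   point would be a crossing. *)
Definition generic d : Prop :=
  forall x y0 y1 y x0 x1 : R,
    vertical_segment d x y0 y1 -> horizontal_segment d y x0 x1 ->
    ~ (x0 < x < x1 /\ y0 < y < y1).

Definition right_step d i j : Prop :=
  exists x y0 y1 : R, [/\ vertical_segment d x y0 y1,
    right_side (tile d i) `<=` vseg x y0 y1 &
    left_side (tile d j) `<=` vseg x y0 y1].

Definition above_step d i j : Prop :=
  exists y x0 x1 : R, [/\ horizontal_segment d y x0 x1,
    top_side (tile d i) `<=` hseg y x0 x1 &
    bottom_side (tile d j) `<=` hseg y x0 x1].

(* [right_of d i j]: tile j is right of tile i; [above d i j]: tile j is above
   tile i.  Chains have at least one step. *)
Definition right_of d : 'I_n -> 'I_n -> Prop := clos_trans 'I_n (right_step d).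
Definition above d : 'I_n -> 'I_n -> Prop := clos_trans 'I_n (above_step d).

End Segments.

Record rectangulation (R : realType) (n : nat) := Rectangulation {
  decomp :> decomposition R n;
  decomp_generic : generic decomp
}.

Section StrongRectangulations.
Context {R : realType} {n : nat}.
Implicit Types r : rectangulation R n.

Definition strong_equiv r1 r2 : Prop :=
  exists phi : 'I_n -> 'I_n, bijective phi /\
    forall i j,
      [/\ right_of r1 i j <-> right_of r2 (phi i) (phi j),
          above r1 i j <-> above r2 (phi i) (phi j)
        & contact (tile r1 i) (tile r1 j) <->
          contact (tile r2 (phi i)) (tile r2 (phi j))].

Definition strong_class r : set (rectangulation R n) :=
  [set r' | strong_equiv r r'].

Definition vertical_segments_reach_top r : Prop :=
  forall x y0 y1 : R, vertical_segment r x y0 y1 -> top_side (box r) (x, y1).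

End StrongRectangulations.

Definition Rs_top (R : realType) (n : nat) : set (set (rectangulation R n)) :=
  [set strong_class r | r in [set r | vertical_segments_reach_top r]].
Arguments Rs_top : clear implicits.

(* Positions are 0-based, so the bound on the entries reads e i <= i; in
   particular all entries are < n. *)
Definition inversion_sequence n (e : {ffun 'I_n -> 'I_n}) : bool :=
  [forall i, e i <= i]%N.

Definition contains n (e : {ffun 'I_n -> 'I_n}) (f : seq nat) : bool :=
  [exists s : {ffun 'I_(size f) -> 'I_n},
    [forall a : 'I_(size f), forall b : 'I_(size f), (a < b) ==> (s a < s b)] &&
    [forall a : 'I_(size f), forall b : 'I_(size f),
      ((e (s a) < e (s b)) == (nth 0 f a < nth 0 f b)) &&
      ((e (s a) == e (s b)) == (nth 0 f a == nth 0 f b))]]%N.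

Definition inv_seqs n (T : seq (seq nat)) : {set {ffun 'I_n -> 'I_n}} :=
  [set e | inversion_sequence e && all (fun f => ~~ contains e f) T]%SET.

(* Main.v *)
(* All vertical segments end on the top side, so no segment ends on a horizontal segment from
   below, and each horizontal segment is the top side of a single tile.  Number the tiles by
   increasing left side and, within a column of tiles with the same left side, from top to
   bottom, and let e_j count the tiles i whose right side lies strictly left of the left side of
   j, or on the same vertical line with the bottom of i below the top of j.  Then e is an
   inversion sequence that avoids 010, 101, 120, 201.  Read in this order, e tells which tiles
   have been closed on the right and how heights interleave on both sides of each vertical
   segment, so it determines the strong class; conversely, a rectangulation with a given code is
   built tile by tile, opening a new column when the next entry is a strict maximum, and
   splitting the last tile otherwise.

   The three classes of inversion sequences have isomorphic generating trees: a sequence of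
   length n with maximum M and exactly a possible next entries not exceeding M has children with
   labels (n+1, M, j) for 1 <= j <= a and (n+1, v, v - M) for M < v <= n. *)
Require Import Defs.
From mathcomp Require Import all_boot all_order all_algebra.
From mathcomp Require Import all_classical all_reals.
From mathcomp Require Import topology normedtype.
From mathcomp Require Import zify lra.
From Stdlib Require Import Relation_Operators.

Set Implicit Arguments.
Unset Strict Implicit.
Unset Printing Implicit Defensive.

Import Order.TTheory GRing.Theory Num.Theory.

(** * Inversion sequences *)

Section InversionSequences.
Local Open Scope nat_scope.

(** The code records only cardinalities. Each of them determines the set that it counts, because the
    sets concerned are closed upwards or downwards in a total order, [lower], which can itself be
    read from the code. The four patterns arise because codes descend weakly within a column, while
    every code in a later column exceeds every code in an earlier one; [bad1] expresses exactly this
    shape. Contact across a vertical line takes two height inequalities, of which the code counts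
    one; the other reduces to the counted kind for neighbouring tiles, where genericity excludes a
    tie. Contact across a horizontal line is the covering relation of the above-below order.
    Conversely, contacts are what makes the code an invariant of the strong class. The combinatorics
    is done on a [frame] of bare coordinates, so that the geometry becomes linear arithmetic; point
    sets occur only in the translation from the definitions. *)

Lemma contains3 n (e : {ffun 'I_n -> 'I_n}) (a b c : nat) :
  contains e [:: a; b; c] <->
  exists i j k : 'I_n, [/\ i < j < k,
    (e i < e j) = (a < b) /\ (e j < e i) = (b < a),
    (e i < e k) = (a < c) /\ (e k < e i) = (c < a)
    & (e j < e k) = (b < c) /\ (e k < e j) = (c < b)].
Proof.
split.
  case/existsP=> s /andP[/forallP mono /forallP iso].
  have iso' x y : (e (s x) < e (s y)) = (nth 0 [:: a; b; c] x < nth 0 [:: a; b; c] y).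
    by move/forallP: (iso x) => /(_ y) /andP[/eqP].
  have mono' (x y : 'I_3) : x < y -> s x < s y.
    by move=> xy; move/forallP: (mono x) => /(_ y) /implyP; apply.
  pose o0 : 'I_3 := Ordinal (erefl (0 < 3)).
  pose o1 : 'I_3 := Ordinal (erefl (1 < 3)).
  pose o2 : 'I_3 := Ordinal (erefl (2 < 3)).
  exists (s o0), (s o1), (s o2).
  split; [by rewrite !mono'| by rewrite !iso' | by rewrite !iso' | by rewrite !iso'].
case=> i [j [k [/andP[ij jk] [ab ba] [ac ca] [bc cb]]]].
apply/existsP; exists [ffun x : 'I_3 => if val x == 0 then i else if val x == 1 then j else k].
have ik : i < k by apply: ltn_trans jk.
apply/andP; split; apply/forallP=> -[[|[|[|//]]] px]; apply/forallP=> -[[|[|[|//]]] py];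
  rewrite ?ffunE //= -?(inj_eq val_inj) /= ?ab ?ba ?ac ?ca ?bc ?cb ?ltnn ?eqxx //;
  lia.
Qed.

(** Each predicate merges four order types. The common disjunct [z <= x < y] is 010 together with
    120; the other one is 101 with 201, 110 with 210, and 100 with 210 respectively. *)
Definition bad1 x y z := (x < y) && (z <= x) || (y < z <= x).
Definition bad2 x y z := (x < y) && (z <= x) || (z < y <= x).
Definition bad3 x y z := (x < y) && (z <= x) || (z <= y < x).

Definition admissible (bad : nat -> nat -> nat -> bool) n (e : {ffun 'I_n -> 'I_n}) :=
  (forall i, e i <= i) /\
  (forall i j k : 'I_n, i < j < k -> ~~ bad (e i) (e j) (e k)).

(** The six strict comparisons fix the order type of a triple, equalities included, so avoiding the
    four patterns is a single test on triples. *)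
Lemma inv_seqs_admissible n (p q r s : nat * nat * nat) bad e :
  (forall x y z,
    bad x y z = has (fun p : nat * nat * nat => let: (a, b, c) := p in
      [&& (x < y) == (a < b), (y < x) == (b < a), (x < z) == (a < c), (z < x) == (c < a),
          (y < z) == (b < c) & (z < y) == (c < b)]) [:: p; q; r; s]) ->
  e \in inv_seqs n [seq [:: p.1.1; p.1.2; p.2] | p <- [:: p; q; r; s]] <->
  admissible bad e.
Proof.
move=> badE; rewrite inE all_map; split.
  case/andP=> /forallP inv /allP av; split=> // i j k ijk; apply/negP.
  rewrite badE => /hasP[[[a b] c] /av /negP nc].
  case/and5P=> /eqP ? /eqP ? /eqP ? /eqP ? /andP[/eqP ? /eqP ?].
  by apply: nc; apply/contains3; exists i, j, k; split.
case=> inv av; apply/andP; split; first exact/forallP.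
apply/allP=> -[[a b] c] pin /=; apply/negP => /contains3[i [j [k]]].
case=> ijk [h1 h2] [h3 h4] [h5 h6]; move/negP: (av _ _ _ ijk); apply.
by rewrite badE; apply/hasP; exists (a, b, c); rewrite //= h1 h2 h3 h4 h5 h6 !eqxx.
Qed.

Lemma inv_seqs1 n e :
  e \in inv_seqs n [:: [:: 0; 1; 0]; [:: 1; 0; 1]; [:: 1; 2; 0]; [:: 2; 0; 1]] <->
  admissible bad1 e.
Proof.
apply: (@inv_seqs_admissible n (0, 1, 0) (1, 0, 1) (1, 2, 0) (2, 0, 1)) => x y z /=.
by rewrite /bad1; lia.
Qed.

Lemma inv_seqs2 n e :
  e \in inv_seqs n [:: [:: 0; 1; 0]; [:: 1; 1; 0]; [:: 1; 2; 0]; [:: 2; 1; 0]] <->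
  admissible bad2 e.
Proof.
apply: (@inv_seqs_admissible n (0, 1, 0) (1, 1, 0) (1, 2, 0) (2, 1, 0)) => x y z /=.
by rewrite /bad2; lia.
Qed.

Lemma inv_seqs3 n e :
  e \in inv_seqs n [:: [:: 0; 1; 0]; [:: 1; 0; 0]; [:: 1; 2; 0]; [:: 2; 1; 0]] <->
  admissible bad3 e.
Proof.
apply: (@inv_seqs_admissible n (0, 1, 0) (1, 0, 0) (1, 2, 0) (2, 1, 0)) => x y z /=.
by rewrite /bad3; lia.
Qed.

(** * Reversed words, extension by one entry, and the generating tree *)

Section Generation.
Variable bad : nat -> nat -> nat -> bool.

(* Sequences are stored in reverse: the head of the list is the last entry. *)
Fixpoint appendable (s : seq nat) (v : nat) : bool :=
  if s is u :: s' then appendable s' v && all (fun x => ~~ bad x u v) s' else true.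

Fixpoint valid (s : seq nat) : bool :=
  if s is v :: s' then [&& valid s', v <= size s' & appendable s' v] else true.

Fixpoint avoiders n : seq (seq nat) :=
  if n is n'.+1 then
    flatten [seq [seq v :: s | v <- iota 0 n & appendable s v] | s <- avoiders n']
  else [:: [::]].

Lemma mem_avoiders n s : (s \in avoiders n) = (size s == n) && valid s.
Proof.
elim: n s => [|n IH] s; first by case: s.
apply/flattenP/idP => [[_ /mapP[t tg ->] /mapP[v]]|].
  rewrite mem_filter mem_iota /= add0n => /andP[fv vn] -> /=.
  by move: tg; rewrite IH eqSS => /andP[/eqP-> ->]; rewrite eqxx fv -ltnS vn.
case: s => [|v t] //=; rewrite eqSS => /andP[/eqP sz /and3P[vt vn fv]].
exists [seq v :: t | v <- iota 0 n.+1 & appendable t v].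
  by apply/mapP; exists t; rewrite // IH sz eqxx.
by apply/mapP; exists v; rewrite // mem_filter mem_iota fv ltnS -sz.
Qed.

Lemma avoiders_uniq n : uniq (avoiders n).
Proof.
elim: n => [|n IH] //; apply: allpairs_uniq_dep => //.
  by move=> s _; apply/filter_uniq/iota_uniq.
by move=> [s v] [t w] _ _ /= [-> ->].
Qed.

Lemma appendableP s v :
  reflect (forall i j, j < i < size s -> ~~ bad (nth 0 s i) (nth 0 s j) v) (appendable s v).
Proof.
elim: s => [|u s IH] /=; first by apply: ReflectT => i j; rewrite ltn0 andbF.
apply: (iffP andP) => [[/IH fs /allP us] [//|i] [|j] /=|h].
- by move=> si; apply: us; rewrite mem_nth.
- by rewrite !ltnS; apply: fs.
split; first by apply/IH => i j ij; exact: (h i.+1 j.+1).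
by apply/(all_nthP 0) => i si; exact: (h i.+1 0).
Qed.

(** Index [k] of the reversed list is position [size s - k.+1] of the sequence; hence the bound on
    the entries and the reversed order of [i], [j], [k]. *)
Lemma validP s :
  reflect ((forall k, k < size s -> nth 0 s k <= size s - k.+1) /\
           (forall i j k, k < j < i -> i < size s ->
             ~~ bad (nth 0 s i) (nth 0 s j) (nth 0 s k)))
          (valid s).
Proof.
elim: s => [|v s IH] /=; first by apply: ReflectT; split.
apply: (iffP and3P) => [[/IH[h1 h2] vs /appendableP fs]|[h1 h2]].
  split=> [[_|k ks]|i j k].
  - by rewrite subSS subn0.
  - by rewrite subSS; apply: h1.
  case: i j k => [|i] [|j] [|k] //=; rewrite ?ltnS => ij si; rewrite ?andbF // in ij *.
    by apply: fs; rewrite ij si.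
  exact: h2.
split.
- apply/IH; split=> [k ks|i j k ijk si]; first by move: (h1 k.+1 ks); rewrite subSS.
  exact: (h2 i.+1 j.+1 k.+1).
- by move: (h1 0 isT); rewrite subSS subn0.
- by apply/appendableP => i j /andP[ij si]; apply: (h2 i.+1 j.+1 0).
Qed.

Definition word n (e : {ffun 'I_n -> 'I_n}) : seq nat := rev [seq val (e i) | i <- enum 'I_n].

Lemma size_word n (e : {ffun 'I_n -> 'I_n}) : size (word e) = n.
Proof. by rewrite size_rev size_map size_enum_ord. Qed.

Lemma nth_word n (e : {ffun 'I_n -> 'I_n}) (i : 'I_n) : nth 0 (word e) (n - i.+1) = e i.
Proof.
rewrite nth_rev size_map size_enum_ord; last by case: i => /=; lia.
have -> : n - (n - i.+1).+1 = i by case: i => /=; lia.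
by rewrite (nth_map i) ?size_enum_ord // nth_ord_enum.
Qed.

Lemma word_valid n (e : {ffun 'I_n -> 'I_n}) : admissible bad e <-> valid (word e).
Proof.
split=> [[h1 h2]|/validP].
  apply/validP; rewrite size_word; split=> [k kn|i j k ijk ni].
    have kn' : n - k.+1 < n by lia.
    have kE : n - (Ordinal kn').+1 = k by rewrite /=; lia.
    by rewrite -{1}kE nth_word; exact: h1.
  have [a ai] : exists a : 'I_n, n - a.+1 = i.
    have h : n - i.+1 < n by lia.
    by exists (Ordinal h) => /=; lia.
  have [b bj] : exists a : 'I_n, n - a.+1 = j.
    have h : n - j.+1 < n by lia.
    by exists (Ordinal h) => /=; lia.
  have [c ck] : exists a : 'I_n, n - a.+1 = k.
    have h : n - k.+1 < n by lia.
    by exists (Ordinal h) => /=; lia.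
  by rewrite -ai -bj -ck !nth_word; apply: h2; lia.
rewrite size_word => -[h1 h2]; split=> [i|i j k ijk].
  by rewrite -nth_word (leq_trans (h1 _ _)) //; case: i => /=; lia.
by rewrite -!nth_word; apply: h2; case: i j k ijk => [i ?] [j ?] [k ?] /=; lia.
Qed.

Lemma valid_word n s : size s = n -> valid s -> exists e : {ffun 'I_n -> 'I_n}, word e = s.
Proof.
move=> sz /validP[h1 _].
have bd (i : 'I_n) : nth 0 s (n - i.+1) < n.
  by case: i => i ni /=; have := h1 (n - i.+1); rewrite sz => /(_ _); lia.
exists [ffun i => Ordinal (bd i)]; apply: (@eq_from_nth _ 0); rewrite size_word //.
move=> k kn; have kn' : n - k.+1 < n by lia.
have kE : n - (Ordinal kn').+1 = k by rewrite /=; lia.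
by rewrite -{1}kE nth_word ffunE; congr nth.
Qed.

Lemma word_inj n : injective (@word n).
Proof.
by move=> e f ef; apply/ffunP => i; apply/val_inj; rewrite /= -!nth_word ef.
Qed.

Lemma card_admissible n (A : {set {ffun 'I_n -> 'I_n}}) :
  (forall e, e \in A <-> admissible bad e) -> #|A| = size (avoiders n).
Proof.
move=> AE; rewrite cardE -(size_map (@word n)); apply/perm_size/uniq_perm.
- by rewrite map_inj_uniq ?enum_uniq //; exact: word_inj.
- exact: avoiders_uniq.
move=> s; rewrite mem_avoiders; apply/mapP/andP => [[e]|[/eqP sz vs]].
  by rewrite mem_enum => /AE/word_valid v ->; rewrite size_word eqxx.
have [e eE] := valid_word sz vs; exists e => //.
by rewrite mem_enum; apply/AE/word_valid; rewrite eE.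
Qed.

End Generation.

(* A node (n, M, a) stands for a sequence of length n with maximum M and exactly a
   possible next entries not exceeding M. *)
Definition children (p : nat * nat * nat) : seq (nat * nat * nat) :=
  let: (n, M, a) := p in
  [seq (n.+1, M, j) | j <- iota 1 a] ++ [seq (n.+1, v, v - M) | v <- iota M.+1 (n - M)].

(** The root is the empty sequence: maximum 0 by convention, and 0 as the one possible next
    entry. *)
Definition level n := iter n (fun l => flatten (map children l)) [:: (0, 0, 1)].

(** If the labels of the children depend only on the label of the parent, then by induction the
    labels of the sequences of length [n] are the [n]-th level as a multiset. *)
Lemma size_avoiders_level bad (lab : seq nat -> nat * nat * nat) n :
  lab [::] = (0, 0, 1) ->
  (forall s, valid bad s ->
    perm_eq [seq lab (v :: s) | v <- iota 0 (size s).+1 & appendable bad s v] (children (lab s))) ->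
  size (avoiders bad n) = size (level n).
Proof.
move=> lab0 labS; rewrite -(size_map lab); apply: perm_size.
elim: n => [|n IH]; first by rewrite /= lab0.
have -> : level n.+1 = flatten (map children (level n)) by [].
rewrite [avoiders _ _]/= map_flatten -map_comp.
have := perm_flatten (perm_map children IH).
rewrite -map_comp; apply: perm_trans.
have : {subset avoiders bad n <= avoiders bad n} by [].
(* Generalises to any list of members of [avoiders bad n]; [sub] keeps their validity and length. *)
elim: {1 3 4}(avoiders bad n) => [|s l IHl] sub //=; apply: perm_cat.
  have := sub _ (mem_head _ _); rewrite mem_avoiders => /andP[/eqP <- vs].
  by rewrite -map_comp; apply: labS.
by apply: IHl => t tl; apply: sub; rewrite inE tl orbT.
Qed.

(** In all three classes the possible next entries form an interval [[lo, hi]] not exceeding the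
    maximum, together with all larger values up to [n]. The larger values always give the same
    labels, so only the hypothesis on the interval is specific to a class. *)
Lemma children_perm (lab : nat -> nat * nat * nat) (fr : pred nat) n M lo hi :
  lo <= hi <= M ->
  M <= n ->
  (forall v, fr v = (lo <= v <= hi) || (M < v)) ->
  (forall v, M < v -> lab v = (n.+1, v, v - M)) ->
  perm_eq [seq lab v | v <- iota lo (hi.+1 - lo)]
          [seq (n.+1, M, j) | j <- iota 1 (hi.+1 - lo)] ->
  perm_eq [seq lab v | v <- iota 0 n.+1 & fr v] (children (n, M, hi.+1 - lo)).
Proof.
move=> lohi Mn frE labE pl.
have pv : perm_eq [seq v <- iota 0 n.+1 | fr v] (iota lo (hi.+1 - lo) ++ iota M.+1 (n - M)).
  apply: uniq_perm; first by rewrite filter_uniq ?iota_uniq.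
    rewrite cat_uniq !iota_uniq andbT /=; apply/hasPn => v.
    by rewrite !mem_iota; lia.
  by move=> v; rewrite mem_filter mem_cat !mem_iota frE; lia.
apply: perm_trans (perm_map _ pv) _; rewrite map_cat perm_cat //.
have /eq_in_map -> // : {in iota M.+1 (n - M), lab =1 fun v => (n.+1, v, v - M)}.
by move=> v; rewrite mem_iota => /andP[Mv _]; exact: labE.
Qed.

(** An injection of [a] integers into [1, ..., a] is onto. *)
Lemma perm_iota_node (f : nat -> nat) (lab : nat -> nat * nat * nat) n M lo a :
  (forall v v' : nat, lo <= v < lo + a -> lo <= v' < lo + a -> f v = f v' -> v = v') ->
  (forall v : nat, lo <= v < lo + a -> 1 <= f v <= a /\ lab v = (n, M, f v)) ->
  perm_eq [seq lab v | v <- iota lo a] [seq (n, M, j) | j <- iota 1 a].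
Proof.
move=> fi fb.
have -> : map lab (iota lo a) = map (fun j => (n, M, j)) (map f (iota lo a)).
  by rewrite -map_comp; apply/eq_in_map => v; rewrite mem_iota => /fb[].
apply: perm_map; have u : uniq (map f (iota lo a)).
  by rewrite map_inj_in_uniq ?iota_uniq // => v v'; rewrite !mem_iota; apply: fi.
apply: uniq_perm; rewrite ?iota_uniq //.
apply: (uniq_min_size u _ _).2; rewrite ?size_map ?size_iota // => x /mapP[v].
by rewrite mem_iota => /fb[vb _] ->; rewrite mem_iota add1n ltnS.
Qed.

(** [M] is the maximum, and [[b, w]] holds the possible next entries not exceeding it. After a new
    maximum, all values up to the old one are blocked through [z <= x < y]; after any other entry
    [v], the values in [(v, M]] are blocked through [y < z <= x]. So [w] is the last entry of a
    nonempty sequence. *)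
Fixpoint state1 (s : seq nat) : nat * nat * nat :=
  if s is v :: s' then
    let: (M, b, w) := state1 s' in if M < v then (v, M.+1, v) else (M, b, v)
  else (0, 0, 0).

(** [M \in s] supplies the earlier entry that blocks the excluded values; since no entry lies in
    [[b, w)], nothing else is blocked. *)
Lemma state1P s M b w : valid bad1 s -> state1 s = (M, b, w) ->
  [/\ b <= w <= M, M <= (size s).-1, s = [::] \/ M \in s,
      (forall x, x \in s -> x <= M /\ (x < b \/ w <= x)) &
      forall v, appendable bad1 s v = (b <= v <= w) || (M < v)].
Proof.
elim: s M b w => [|u s IH] M b w /=.
  move=> _ [<- <- <-]; split=> //; first by left.
  by case.
case/and3P=> vs us; case E : (state1 s) => [[M' b'] w'].
have {IH} [bwM Ms nil Mb frE] := IH _ _ _ vs E.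
rewrite frE; case: ltnP => Mu; last first.
  rewrite orbF => bu [<- <- <-]; split=> //.
  - by lia.
  - by lia.
  - right; rewrite inE; case: nil => [s0|->]; last by rewrite orbT.
    by move: us Ms Mu; rewrite s0 /=; lia.
  - move=> x; rewrite inE => /predU1P[->|/Mb]; lia.
  move=> v; rewrite frE; apply/andP/idP => [[fv /allP al]|].
    have [?|uv] := leqP v u; first by lia.
    have [s0|/al] := nil; first by move: us Ms; rewrite s0 /=; lia.
    by rewrite /bad1; lia.
  by move=> h; split; [lia|apply/allP => x /Mb; rewrite /bad1; lia].
move=> _ [<- <- <-]; split=> //.
- by rewrite Mu leqnn.
- by right; rewrite inE eqxx.
- by move=> x; rewrite inE => /predU1P[->|/Mb]; lia.
move=> v; rewrite frE; apply/andP/idP => [[fv /allP al]|].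
  have [s0|/al] := nil; first by move: us; rewrite s0 /=; lia.
  by rewrite /bad1; lia.
by move=> h; split; [lia|apply/allP => x /Mb; rewrite /bad1; lia].
Qed.

Lemma size_avoiders1 n : size (avoiders bad1 n) = size (level n).
Proof.
apply: (size_avoiders_level (lab := fun s => let: (M, b, w) := state1 s in (size s, M, w.+1 - b))).
  by [].
move=> s vs; case E: (state1 s) => [[M b] w].
have [bwM Ms _ _ frE] := state1P vs E.
apply: children_perm => //=; first by lia.
- by move=> v Mv; rewrite E Mv; congr (_, _, _); lia.
apply: (@perm_iota_node (fun v => v.+1 - b)).
- by move=> v v'; lia.
by move=> v h; rewrite E; split; [lia|case: ltnP => //; lia].
Qed.

(** All values from [d] to [M] stay possible. A new maximum moves [d] past the old one; any other
    entry [v] blocks the values below it through [z < y <= x] with [x = M]. *)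
Fixpoint state2 (s : seq nat) : nat * nat :=
  if s is v :: s' then let: (M, d) := state2 s' in if M < v then (v, M.+1) else (M, v)
  else (0, 0).

Lemma state2P s M d : valid bad2 s -> state2 s = (M, d) ->
  [/\ d <= M, M <= (size s).-1, s = [::] \/ M \in s,
      (forall x, x \in s -> x <= M) & forall v, appendable bad2 s v = (d <= v)].
Proof.
elim: s M d => [|u s IH] M d /=.
  by move=> _ [<- <-]; split=> //; left.
case/and3P=> vs us; case E : (state2 s) => [M' d'].
have {IH} [dM Ms nil Mb frE] := IH _ _ vs E.
rewrite frE; case: ltnP => Mu du [<- <-]; split=> //.
- by right; rewrite inE eqxx.
- by move=> x; rewrite inE => /predU1P[->|/Mb]; lia.
- move=> v; rewrite frE; apply/andP/idP => [[fv /allP al]|].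
    have [s0|/al] := nil; first by move: us; rewrite s0 /=; lia.
    by rewrite /bad2; lia.
  by move=> h; split; [lia|apply/allP => x /Mb; rewrite /bad2; lia].
- by lia.
- right; rewrite inE; case: nil => [s0|->]; last by rewrite orbT.
  by move: us Ms Mu; rewrite s0 /=; lia.
- by move=> x; rewrite inE => /predU1P[->|/Mb]; lia.
move=> v; rewrite frE; apply/andP/idP => [[fv /allP al]|].
  have [s0|/al] := nil; first by move: us; rewrite s0 /=; lia.
  by rewrite /bad2; lia.
by move=> h; split; [lia|apply/allP => x /Mb; rewrite /bad2; lia].
Qed.

Lemma size_avoiders2 n : size (avoiders bad2 n) = size (level n).
Proof.
apply: (size_avoiders_level (lab := fun s => let: (M, d) := state2 s in (size s, M, M.+1 - d))).
  by [].
move=> s vs; case E: (state2 s) => [M d].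
have [dM Ms _ _ frE] := state2P vs E.
apply: children_perm => //=; first by rewrite dM leqnn.
- by lia.
- by move=> v; rewrite frE; lia.
- by move=> v Mv; rewrite E Mv; congr (_, _, _); lia.
apply: (@perm_iota_node (fun v => M.+1 - v)).
- by move=> v v'; lia.
by move=> v h; rewrite E; split; [lia|case: ltnP => //; lia].
Qed.

(** Repeating the maximum blocks nothing new, as all other entries are already below [d]. A smaller
    entry [v] blocks itself too, through [z <= y < x] with [x = M], hence [v.+1]. *)
Fixpoint state3 (s : seq nat) : nat * nat :=
  if s is v :: s' then
    let: (M, d) := state3 s' in
    if M < v then (v, M.+1) else if v == M then (M, d) else (M, v.+1)
  else (0, 0).

Lemma state3P s M d : valid bad3 s -> state3 s = (M, d) ->
  [/\ d <= M, M <= (size s).-1, s = [::] \/ M \in s,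
      (forall x, x \in s -> x < d \/ x = M) & forall v, appendable bad3 s v = (d <= v)].
Proof.
elim: s M d => [|u s IH] M d /=.
  by move=> _ [<- <-]; split=> //; left.
case/and3P=> vs us; case E : (state3 s) => [M' d'].
have {IH} [dM Ms nil Mb frE] := IH _ _ vs E.
rewrite frE; case: ltnP => Mu du; last case: eqP => uM; move=> [<- <-]; split=> //.
- by right; rewrite inE eqxx.
- by move=> x; rewrite inE => /predU1P[->|/Mb]; lia.
- move=> v; rewrite frE; apply/andP/idP => [[fv /allP al]|].
    have [s0|/al] := nil; first by move: us; rewrite s0 /=; lia.
    by rewrite /bad3; lia.
  by move=> h; split; [lia|apply/allP => x /Mb; rewrite /bad3; lia].
- by lia.
- by right; rewrite uM mem_head.
- by move=> x; rewrite inE => /predU1P[->|/Mb]; lia.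
- move=> v; rewrite frE; apply/andP/idP => [[]//|h].
  by split=> //; apply/allP => x /Mb; rewrite /bad3; lia.
- by lia.
- by lia.
- right; rewrite inE; case: nil => [s0|->]; last by rewrite orbT.
  by move: us Ms Mu; rewrite s0 /=; lia.
- by move=> x; rewrite inE => /predU1P[->|/Mb]; lia.
move=> v; rewrite frE; apply/andP/idP => [[fv /allP al]|].
  have [s0|/al] := nil; first by move: us Ms uM Mu; rewrite s0 /=; lia.
  by rewrite /bad3; lia.
by move=> h; split; [lia|apply/allP => x /Mb; rewrite /bad3; lia].
Qed.

Lemma size_avoiders3 n : size (avoiders bad3 n) = size (level n).
Proof.
apply: (size_avoiders_level (lab := fun s => let: (M, d) := state3 s in (size s, M, M.+1 - d))).
  by [].
move=> s vs; case E: (state3 s) => [M d].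
have [dM Ms _ _ frE] := state3P vs E.
apply: children_perm => //=; first by rewrite dM leqnn.
- by lia.
- by move=> v; rewrite frE; lia.
- by move=> v Mv; rewrite E Mv; congr (_, _, _); lia.
(* Repeating [M] keeps all [M.+1 - d] values, and [v < M] leaves the [M - v] values above it:
   together these are [1, ..., M.+1 - d]. *)
apply: (@perm_iota_node (fun v => if v == M then M.+1 - d else M - v)).
- by move=> v v'; case: (eqVneq v M) => [->|?]; case: (eqVneq v' M) => [->|?]; lia.
move=> v h; rewrite E; split; first by case: eqP; lia.
case: ltnP => [|_]; first by lia.
by case: eqP => // _; congr (_, _, _); lia.
Qed.

End InversionSequences.

(** * Rectangulations in coordinates *)

Section Frames.
Context {R : realFieldType}.
Local Open Scope ring_scope.
Implicit Types x y z : R.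

(** Coordinates without any inequality, so that [transpose] turns results on vertical lines into
    results on horizontal ones. *)
Record frame (I : Type) := Frame {
  lf : I -> R; rg : I -> R; lo : I -> R; hi : I -> R;
  box_lf : R; box_rg : R; box_lo : R; box_hi : R
}.

Definition transpose I (F : frame I) :=
  Frame (lo F) (hi F) (lf F) (rg F) (box_lo F) (box_hi F) (box_lf F) (box_rg F).

Definition relabel I J (F : frame I) (s : J -> I) :=
  Frame (lf F \o s) (rg F \o s) (lo F \o s) (hi F \o s)
    (box_lf F) (box_rg F) (box_lo F) (box_hi F).

Definition xmeet I (F : frame I) i j := (lf F i < rg F j) && (lf F j < rg F i).
Definition ymeet I (F : frame I) i j := (lo F i < hi F j) && (lo F j < hi F i).

Record tiling I (F : frame I) : Prop := Tiling {
  tile_x : forall i, [/\ box_lf F <= lf F i, lf F i < rg F i & rg F i <= box_rg F];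
  tile_y : forall i, [/\ box_lo F <= lo F i, lo F i < hi F i & hi F i <= box_hi F];
  tile_disj : forall i j, xmeet F i j -> ymeet F i j -> i = j;
  tile_cov : forall x y, box_lf F <= x <= box_rg F -> box_lo F <= y <= box_hi F ->
    exists i, lf F i <= x <= rg F i /\ lo F i <= y <= hi F i
}.

Lemma tiling_transpose I (F : frame I) : tiling F -> tiling (transpose F).
Proof.
case=> tx ty td tc; split=> //= [i j yij xij|x y xb yb]; first exact: td.
by have [i [? ?]] := tc y x yb xb; exists i.
Qed.

(** A point so close to [x] that no larger coordinate of the finite list is passed on the way; such
    shifts select a quadrant at a point. *)
Lemma near_right (s : seq R) (x : R) : exists2 x', x < x' & {in s, forall c, x < c -> x' < c}.
Proof.
elim: s => [|c s [x' xx' IH]]; first by exists (x + 1); rewrite ?ltrDl.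
have [xc|cx] := ltP x c; last first.
  by exists x' => // d; rewrite inE => /predU1P[->|/IH //]; rewrite ltNge cx.
have [m [xm mx' mc]] : exists m, [/\ x < m, m <= x' & m <= c].
  by have [h|h] := leP x' c; [exists x'|exists c]; split=> //; exact: ltW.
exists ((x + m) / 2); first lra.
by move=> d; rewrite inE => /predU1P[->|/IH ds] xd; [|have := ds xd]; lra.
Qed.

Lemma near_left (s : seq R) (x : R) : exists2 x', x' < x & {in s, forall c, c < x -> c < x'}.
Proof.
have [x' xx' h] := near_right (map -%R s) (- x).
exists (- x'); first by rewrite ltrNl.
by move=> c cs cx; rewrite ltrNr; apply: h; rewrite ?map_f // ltrN2.
Qed.

(** * Tiles in the four quadrants at a point *)

Section Corners.
Variables (I : finType) (F : frame I).
Hypothesis tF : tiling F.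

Let near_r (f : I -> R) (b x : R) :
  exists x', [/\ x < x', x < b -> x' < b & forall i, x < f i -> x' < f i].
Proof.
have [x' xx' h] := near_right (b :: codom f) x; exists x'; split=> //.
  by apply: h; rewrite mem_head.
by move=> i; apply: h; rewrite inE codom_f orbT.
Qed.

Let near_l (f : I -> R) (b x : R) :
  exists x', [/\ x' < x, b < x -> b < x' & forall i, f i < x -> f i < x'].
Proof.
have [x' xx' h] := near_left (b :: codom f) x; exists x'; split=> //.
  by apply: h; rewrite mem_head.
by move=> i; apply: h; rewrite inE codom_f orbT.
Qed.

(** The suffix names the quadrant, horizontal direction first, [p] for larger and [m] for smaller
    coordinates. A tile covering a nearby point of the quadrant fills the quadrant close to
    [(x, y)]. *)
Lemma corner_pp x y : box_lf F <= x < box_rg F -> box_lo F <= y < box_hi F ->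
  exists i, lf F i <= x < rg F i /\ lo F i <= y < hi F i.
Proof.
move=> /andP[x0 x1] /andP[y0 y1].
have [x' [xx' /(_ x1) xb xl]] := near_r (lf F) (box_rg F) x.
have [y' [yy' /(_ y1) yb yl]] := near_r (lo F) (box_hi F) y.
have [||i [/andP[a b] /andP[c d]]] := tile_cov tF (x := x') (y := y'); try lra.
exists i; split; apply/andP; split; try lra.
  by rewrite leNgt; apply/negP => /xl; lra.
by rewrite leNgt; apply/negP => /yl; lra.
Qed.

Lemma corner_pm x y : box_lf F <= x < box_rg F -> box_lo F < y <= box_hi F ->
  exists i, lf F i <= x < rg F i /\ lo F i < y <= hi F i.
Proof.
move=> /andP[x0 x1] /andP[y0 y1].
have [x' [xx' /(_ x1) xb xl]] := near_r (lf F) (box_rg F) x.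
have [y' [yy' /(_ y0) yb yl]] := near_l (hi F) (box_lo F) y.
have [||i [/andP[a b] /andP[c d]]] := tile_cov tF (x := x') (y := y'); try lra.
exists i; split; apply/andP; split; try lra.
  by rewrite leNgt; apply/negP => /xl; lra.
by rewrite leNgt; apply/negP => /yl; lra.
Qed.

Lemma corner_mp x y : box_lf F < x <= box_rg F -> box_lo F <= y < box_hi F ->
  exists i, lf F i < x <= rg F i /\ lo F i <= y < hi F i.
Proof.
move=> /andP[x0 x1] /andP[y0 y1].
have [x' [xx' /(_ x0) xb xl]] := near_l (rg F) (box_lf F) x.
have [y' [yy' /(_ y1) yb yl]] := near_r (lo F) (box_hi F) y.
have [||i [/andP[a b] /andP[c d]]] := tile_cov tF (x := x') (y := y'); try lra.
exists i; split; apply/andP; split; try lra.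
  by rewrite leNgt; apply/negP => /xl; lra.
by rewrite leNgt; apply/negP => /yl; lra.
Qed.

Lemma corner_mm x y : box_lf F < x <= box_rg F -> box_lo F < y <= box_hi F ->
  exists i, lf F i < x <= rg F i /\ lo F i < y <= hi F i.
Proof.
move=> /andP[x0 x1] /andP[y0 y1].
have [x' [xx' /(_ x0) xb xl]] := near_l (rg F) (box_lf F) x.
have [y' [yy' /(_ y0) yb yl]] := near_l (hi F) (box_lo F) y.
have [||i [/andP[a b] /andP[c d]]] := tile_cov tF (x := x') (y := y'); try lra.
exists i; split; apply/andP; split; try lra.
  by rewrite leNgt; apply/negP => /xl; lra.
by rewrite leNgt; apply/negP => /yl; lra.
Qed.

End Corners.

Definition on_line I (F : frame I) x i := (lf F i == x) || (rg F i == x).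

(* The vertical segment {x} * [y0, y1] is a union of sides. *)
Definition side_union I (F : frame I) x y0 y1 :=
  forall y, y0 <= y <= y1 ->
    exists i, [/\ on_line F x i, lo F i <= y <= hi F i, y0 <= lo F i & hi F i <= y1].

(** The strict bounds on [x] stand for not being contained in the boundary of the box;
    [vertical_segmentE] proves the agreement. *)
Definition max_segment I (F : frame I) x y0 y1 :=
  [/\ y0 < y1, box_lf F < x < box_rg F, side_union F x y0 y1
    & forall z0 z1, side_union F x z0 z1 -> z0 <= y0 -> y1 <= z1 -> z0 = y0 /\ z1 = y1].

Lemma side_union_tile I (F : frame I) x i : on_line F x i ->
  side_union F x (lo F i) (hi F i).
Proof. by move=> xi y yi; exists i; split. Qed.

Lemma side_union_join I (F : frame I) x a b c d :
  side_union F x a b -> side_union F x c d -> a <= c <= b -> b <= d ->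
  side_union F x a d.
Proof.
move=> u v /andP[ac cb] bd y /andP[ay yd]; have [yb|by_] := leP y b.
  have [|i [? ? ? ?]] := u y; first by rewrite ay yb.
  by exists i; split=> //; lra.
have [|i [? ? ? ?]] := v y; first by lra.
by exists i; split=> //; lra.
Qed.

Lemma side_union_box I (F : frame I) x y0 y1 : tiling F -> y0 <= y1 ->
  side_union F x y0 y1 -> box_lo F <= y0 /\ y1 <= box_hi F.
Proof.
move=> tF y01 u; have [|i [_ yi ? _]] := u y0; first by rewrite lexx.
have [|j [_ yj _ ?]] := u y1; first by rewrite lexx andbT.
by have [? _ _] := tile_y tF i; have [_ _ ?] := tile_y tF j; split; lra.
Qed.

(** A tile with a side through an interior point of tile [i] would overlap [i]. *)
Lemma side_union_avoid I (F : frame I) x y0 y1 i : tiling F ->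
  side_union F x y0 y1 -> lf F i < x < rg F i -> y0 <= y1 -> hi F i <= y0 \/ y1 <= lo F i.
Proof.
move=> tF u /andP[ix xi] y01.
have [?|h0] := leP (hi F i) y0; first by left.
have [?|h1] := leP y1 (lo F i); first by right.
have [_ iy _] := tile_y tF i.
(* A height on the segment and strictly inside the tile. *)
have [y [yy yi]] : exists y, y0 <= y <= y1 /\ lo F i < y < hi F i.
  have [?|?] := ltP (lo F i) y0; first by exists y0; lra.
  by exists ((lo F i + Num.min y1 (hi F i)) / 2); case: (leP y1 (hi F i)); lra.
have [v [xv yv _ _]] := u y yy.
have [_ vx _] := tile_x tF v.
have vi : v = i.
  by apply: (tile_disj tF); rewrite /xmeet /ymeet; [case/orP: xv => /eqP|]; lra.
by move: xv; rewrite vi => /orP[] /eqP; lra.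
Qed.

(** * Existence and uniqueness of maximal segments *)

Section Maximal.
Variables (I : finType) (F : frame I).

Lemma side_union_ends x y0 y1 : y0 <= y1 -> side_union F x y0 y1 ->
  exists i j, [/\ on_line F x i, lo F i = y0 & hi F j = y1].
Proof.
move=> y01 u; have [|i [xi yi i0 i1]] := u y0; first by rewrite lexx.
have [|j [xj yj j0 j1]] := u y1; first by rewrite lexx andbT.
by exists i, j; split=> //; lra.
Qed.

(** The ends of a side union are bottoms and tops of tiles, so there are finitely many candidates
    and a longest one exists. *)
Lemma max_segment_exists x y0 y1 : box_lf F < x < box_rg F -> y0 < y1 ->
  side_union F x y0 y1 -> exists z0 z1, [/\ max_segment F x z0 z1, z0 <= y0 & y1 <= z1].
Proof.
move=> xb y01 u.
pose P (p : I * I) := `[< [/\ side_union F x (lo F p.1) (hi F p.2), lo F p.1 <= y0 & y1 <= hi F p.2] >].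
have ends z0 z1 : side_union F x z0 z1 -> z0 <= y0 -> y1 <= z1 ->
    exists p, [/\ P p, lo F p.1 = z0 & hi F p.2 = z1].
  move=> v z0y y1z; have [|i [j [_ iz jz]]] := side_union_ends _ v; first lra.
  by exists (i, j); split=> //; apply/asboolP; rewrite /= iz jz.
have [p0 [Pp0 _ _]] := ends _ _ u (lexx _) (lexx _).
pose f (p : I * I) := hi F p.2 - lo F p.1.
case: (arg_maxP f Pp0) => p /asboolP[v py0 py1] pmax.
exists (lo F p.1), (hi F p.2); split=> //; split=> //; first lra.
move=> z0 z1 w z0p z1p; have [||q [Pq q0 q1]] := ends _ _ w; try lra.
by have : f q <= f p := pmax _ Pq; rewrite /f q0 q1 => ?; split; lra.
Qed.

End Maximal.

(** When two side unions on one line meet, their union is again a side union. *)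
Lemma max_segment_eq I (F : frame I) x a b c d :
  max_segment F x a b -> max_segment F x c d -> a <= d -> c <= b -> a = c /\ b = d.
Proof.
wlog ac : a b c d / a <= c => [th|].
  move=> m m' ad cb; have [/th|/ltW/th] := leP a c; first exact.
  by case/(_ _ _ m' m cb ad) => -> ->.
move=> [ab _ u m] [cd _ u' m'] ad cb; have [bd|/ltW db] := leP b d.
  have v : side_union F x a d by apply: side_union_join u u' _ _; rewrite ?ac.
  by have [] := m _ _ v (lexx _) bd; have [] := m' _ _ v ac (lexx _).
by have [] := m' _ _ u ac db.
Qed.

Definition generic_frame I (F : frame I) := forall x y0 y1 y x0 x1,
  max_segment F x y0 y1 -> max_segment (transpose F) y x0 x1 -> ~ (x0 < x < x1 /\ y0 < y < y1).

Definition reaches_top I (F : frame I) :=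
  forall x y0 y1, max_segment F x y0 y1 -> y1 = box_hi F.

(** Genericity and the top condition in terms of tiles alone. The segment through a vertical side of
    [i] runs up to the top, so a tile [j] straddling its line must end below; [no_corner] excludes a
    crossing where two tops join below the top of the box. *)
Record top_tiling I (F : frame I) : Prop := TopTiling {
  top_tiling_tiling :> tiling F;
  cross_lf : forall i j, lf F j < lf F i < rg F j -> hi F j <= lo F i;
  cross_rg : forall i j, lf F j < rg F i < rg F j -> hi F j <= lo F i;
  no_corner : forall i j, rg F i = lf F j -> hi F i = hi F j -> hi F i = box_hi F
}.

Section TopTiling.
Variables (I : finType) (F : frame I).

Lemma side_max_segment x i : tiling F -> box_lf F < x < box_rg F -> on_line F x i ->
  exists y0 y1, [/\ max_segment F x y0 y1, y0 <= lo F i & hi F i <= y1].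
Proof.
move=> tF xb xi; have [_ yi _] := tile_y tF i.
by have [z0 [z1 [? ? ?]]] := max_segment_exists xb yi (side_union_tile xi); exists z0, z1.
Qed.

Lemma top_tiling_of_generic : tiling F -> generic_frame F -> reaches_top F -> top_tiling F.
Proof.
move=> tF gF rF.
have cross x i j : lf F j < x < rg F j -> on_line F x i -> hi F j <= lo F i.
  move=> xj xi; have [bj _ jb] := tile_x tF j; have [_ yj jt] := tile_y tF j.
  have [|y0 [y1 [ms y0i iy1]]] := side_max_segment tF _ xi; first lra.
  have [y01 _ su _] := ms; move: (rF _ _ _ ms) => y1E.
  by have := side_union_avoid tF su xj (ltW y01); lra.
split=> // [i j ij|i j ij|i j xij yij].
- by apply: cross ij _; rewrite /on_line eqxx.
- by apply: cross ij _; rewrite /on_line eqxx orbT.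
have [bi xi ib] := tile_x tF i; have [bi' yi ib'] := tile_y tF i.
have [bj xj jb] := tile_x tF j; have [bj' yj jb'] := tile_y tF j.
apply/eqP; rewrite eq_le ib' leNgt; apply/negP => ilt.
have [||y0 [y1 [ms y0i iy1]]] := side_max_segment (x := rg F i) (i := i) tF; first lra.
  by rewrite /on_line eqxx orbT.
have y1E := rF _ _ _ ms.
(* The tops of [i] and [j] join to a horizontal side union, and the vertical segment between the two
   tiles would cross it. *)
have u : side_union (transpose F) (hi F i) (lf F i) (rg F j).
  apply: (@side_union_join _ _ _ _ (rg F i) (lf F j)); [| |lra|lra].
    apply: (@side_union_tile _ (transpose F)).
    by rewrite /on_line /= eqxx orbT.
  apply: (@side_union_tile _ (transpose F)).
  by rewrite /on_line /= yij eqxx orbT.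
have [||x0 [x1 [ms' ? ?]]] := max_segment_exists _ _ u; rewrite /=; try lra.
by apply: (gF _ _ _ _ _ _ ms ms'); lra.
Qed.

Hypothesis tF : top_tiling F.

Lemma cross_line x i j : on_line F x i -> lf F j < x < rg F j -> hi F j <= lo F i.
Proof. by case/orP=> /eqP <-; [apply: cross_lf|apply: cross_rg]. Qed.

(** Above the lowest side on a line, the tile at the lower right of each point starts on the line,
    since a tile straddling it would violate the cross clauses. So the sides on the line fill it up
    to the top. *)
Lemma top_tiling_reaches_top : reaches_top F.
Proof.
move=> x y0 y1 [y01 xb u mx].
have [|i0 [_ [xi0 _ _]]] := side_union_ends _ u; first lra.
case: (arg_minP (lo F) xi0) => m xm mmin.
have v : side_union F x (lo F m) (box_hi F).
  move=> y /andP[my yb]; have [bm ym mb] := tile_y tF m.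
  have [ym'|ym'] := eqVneq y (lo F m).
    by exists m; rewrite ym'; split=> //; lra.
  have [||i [xi yi]] := corner_pm tF (x := x) (y := y); first lra.
    by rewrite yb andbT (le_lt_trans bm) // lt_neqAle eq_sym ym'.
  have [_ _ ib] := tile_y tF i.
  have xE : lf F i = x.
    apply/eqP; rewrite eq_le; have [-> _] := andP xi; rewrite /= leNgt; apply/negP => ltx.
    by have := cross_line xm (j := i); rewrite ltx /=; lra.
  have li : on_line F x i by rewrite /on_line xE eqxx.
  exists i; split=> //; first lra.
  exact: mmin.
have [||] := mx _ _ v; [|  |by []].
  have [|i [_ [xi <- _]]] := side_union_ends _ u; first lra.
  exact: mmin.
have [|i [xi yi _ ?]] := u y1; first lra.
have [_ _ ib] := tile_y tF i; lra.
Qed.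

(** At a crossing, the two tiles just below the point have equal tops and meet along the vertical
    line, against [no_corner]. *)
Lemma top_tiling_generic : generic_frame F.
Proof.
move=> x y0 y1 y x0 x1 ms [_ yb u _] [xx yy].
have y1E := top_tiling_reaches_top ms; have [y01 xb v _] := ms.
have [|i [_ [xi iy0 _]]] := side_union_ends _ v; first lra.
have avoid j : lo F j < y < hi F j -> rg F j <= x0 \/ x1 <= lf F j.
  by move=> yj; apply: (side_union_avoid (tiling_transpose tF) u yj); lra.
rewrite /= in yb.
have [||j [xj yj]] := corner_mm tF (x := x) (y := y); try lra.
have [||k [xk yk]] := corner_pm tF (x := x) (y := y); try lra.
have jE : rg F j = x.
  apply/eqP; rewrite eq_le; have [_ ->] := andP xj; rewrite andbT leNgt; apply/negP => ltx.
  by have := cross_line xi (j := j); lra.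
have kE : lf F k = x.
  apply/eqP; rewrite eq_le; have [-> _] := andP xk; rewrite /= leNgt; apply/negP => ltx.
  by have := cross_line xi (j := k); lra.
have jy : hi F j = y.
  apply/eqP; rewrite eq_le; have [_ ->] := andP yj; rewrite andbT leNgt; apply/negP => ltx.
  by have := avoid j; lra.
have ky : hi F k = y.
  apply/eqP; rewrite eq_le; have [_ ->] := andP yk; rewrite andbT leNgt; apply/negP => ltx.
  by have := avoid k; lra.
by have := no_corner tF (i := j) (j := k); rewrite jE kE jy ky => /(_ erefl erefl); lra.
Qed.

End TopTiling.

End Frames.

(** * Neighbourhood relations *)

Section Relations.
Context {R : realFieldType} (I : finType) (F : @frame R I).
Local Open Scope ring_scope.
Implicit Types (x y z : R) (i j k : I).

Definition right_rel i j := rg F i <= lf F j.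
Definition above_rel i j := (hi F i <= lo F j) && xmeet F i j.
Definition vtouch i j := (rg F i == lf F j) && ymeet F i j.
Definition htouch i j := (hi F i == lo F j) && xmeet F i j.
Definition touch i j := [|| vtouch i j, vtouch j i, htouch i j | htouch j i].

Hypothesis tF : top_tiling F.

Lemma disj_y i j : i != j -> xmeet F i j -> hi F i <= lo F j \/ hi F j <= lo F i.
Proof.
move=> /eqP ij xij; have [?|h] := leP (hi F i) (lo F j); first by left.
by right; rewrite leNgt; apply/negP => h'; apply: ij; apply: (tile_disj tF); rewrite // /ymeet h' h.
Qed.

(** The tile is found at the top end of the line through the right side of [i]; the cross clauses
    prevent it from straddling that line. *)
Lemma next_tile i : rg F i < box_rg F -> exists k, lf F k = rg F i /\ hi F k = box_hi F.
Proof.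
move=> ib; have [b1 x1 _] := tile_x tF i; have [b2 y1 b3] := tile_y tF i.
have [||k [xk yk]] := corner_pm tF (x := rg F i) (y := box_hi F); try lra.
have [_ _ kb] := tile_y tF k; exists k; split; last lra.
apply/eqP; rewrite eq_le; have [-> _] := andP xk; rewrite /= leNgt; apply/negP => ltx.
by have := cross_rg tF (i := i) (j := k); lra.
Qed.

Lemma prev_tile j : box_lf F < lf F j -> exists k, rg F k = lf F j /\ hi F k = box_hi F.
Proof.
move=> ib; have [_ x1 b1] := tile_x tF j; have [b2 y1 b3] := tile_y tF j.
have [||k [xk yk]] := corner_mm tF (x := lf F j) (y := box_hi F); try lra.
have [_ _ kb] := tile_y tF k; exists k; split; last lra.
apply/eqP; rewrite eq_le; have [_ ->] := andP xk; rewrite andbT leNgt; apply/negP => ltx.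
by have := cross_lf tF (i := j) (j := k); lra.
Qed.

Lemma lower_tile j x : lf F j <= x < rg F j -> box_lo F < lo F j ->
  exists k, lf F k <= x < rg F k /\ hi F k = lo F j.
Proof.
move=> xj yj; have [b1 _ b1'] := tile_x tF j; have [_ y1 b2] := tile_y tF j.
have [||k [xk yk]] := corner_pm tF (x := x) (y := lo F j); try lra.
exists k; split=> //; apply/eqP; rewrite eq_le; have [_ ->] := andP yk; rewrite andbT leNgt.
apply/negP => h; have kj : k = j by apply: (tile_disj tF); rewrite /xmeet /ymeet; lra.
by move: yk; rewrite kj; lra.
Qed.

Definition step (G : @frame R I) i j := exists x y0 y1,
  [/\ max_segment G x y0 y1, rg G i = x /\ y0 <= lo G i, hi G i <= y1,
      lf G j = x /\ y0 <= lo G j & hi G j <= y1].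

(** All segments on a vertical line end at the top, so they coincide. *)
Lemma stepE i j : step F i j <-> rg F i = lf F j.
Proof.
split=> [[x [y0 [y1 [_ [-> _] _ [-> _] _]]]] //|ij].
have [bi xi _] := tile_x tF i; have [_ xj bj] := tile_x tF j.
have [||y0 [y1 [ms ? ?]]] := side_max_segment (x := rg F i) (i := i) tF; first lra.
  by rewrite /on_line eqxx orbT.
have [||z0 [z1 [ms' ? ?]]] := side_max_segment (x := rg F i) (i := j) tF; first lra.
  by rewrite /on_line ij eqxx.
have y1E := top_tiling_reaches_top tF ms; have z1E := top_tiling_reaches_top tF ms'.
have [yz _] : y0 = z0 /\ y1 = z1.
  have [? _ _ _] := ms; have [? _ _ _] := ms'.
  by apply: (max_segment_eq ms ms'); lra.
by exists (rg F i), y0, y1; split=> //; rewrite ?yz // y1E -z1E.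
Qed.

(** A horizontal segment cannot extend past the tile [i] below it: the next tile below would have
    the same top, against [no_corner]. The nesting of x-ranges is what preserves overlap along a
    chain of steps. *)
Lemma step_transpose_sub i j : step (transpose F) i j ->
  [/\ hi F i = lo F j, lf F i <= lf F j & rg F j <= rg F i].
Proof.
case=> y [x0 [x1 [[x01 yb u _] /= [iy x0i] ix1 [jy x0j] jx1]]].
rewrite /= in yb.
have [bi xi ib] := tile_x tF i; have [bi' yi _] := tile_y tF i.
have [bj xj jb] := tile_x tF j.
have avoid k : lo F k < y < hi F k -> rg F k <= x0 \/ x1 <= lf F k.
  by move=> yk; apply: (side_union_avoid (tiling_transpose tF) u yk); lra.
have [/= bx0 x1b] := side_union_box (tiling_transpose tF) (ltW x01) u.
split; first by rewrite iy jy.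
- apply: le_trans x0j; rewrite leNgt; apply/negP => x0i'.
  have [||k [xk yk]] := corner_mm tF (x := lf F i) (y := y); try lra.
  have ky : hi F k = y.
    apply/eqP; rewrite eq_le; have [_ ->] := andP yk; rewrite andbT leNgt; apply/negP => lty.
    by have := avoid k; lra.
  have kx : rg F k = lf F i.
    apply/eqP; rewrite eq_le; have [_ ->] := andP xk; rewrite andbT leNgt; apply/negP => ltx.
    have ki : k = i by apply: (tile_disj tF); rewrite /xmeet /ymeet; lra.
    by move: xk; rewrite ki; lra.
  by have := no_corner tF kx; lra.
apply: le_trans jx1 _; rewrite leNgt; apply/negP => ix1'.
have [||k [xk yk]] := corner_pm tF (x := rg F i) (y := y); try lra.
have ky : hi F k = y.
  apply/eqP; rewrite eq_le; have [_ ->] := andP yk; rewrite andbT leNgt; apply/negP => lty.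
  by have := avoid k; lra.
have kx : rg F i = lf F k.
  apply/eqP; rewrite eq_le andbC; have [-> _] := andP xk; rewrite /= leNgt; apply/negP => ltx.
  have ki : k = i by apply: (tile_disj tF); rewrite /xmeet /ymeet; lra.
  by move: xk; rewrite ki; lra.
by have := no_corner tF kx; lra.
Qed.

Lemma step_transposeE i j : step (transpose F) i j <-> htouch i j.
Proof.
split=> [/step_transpose_sub[ij xij xji]|/andP[/eqP ij xij]].
  have [_ xi _] := tile_x tF i; have [_ xj _] := tile_x tF j.
  by rewrite /htouch ij eqxx /xmeet; lra.
have tT := tiling_transpose tF.
have [bi yi _] := tile_y tF i; have [_ yj bj] := tile_y tF j.
have [_ xi _] := tile_x tF i; have [_ xj _] := tile_x tF j.
have [||x0 [x1 [ms /= ix0 ix1]]] := side_max_segment (x := hi F i) (i := i) tT; first by rewrite /=; lra.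
  by rewrite /on_line /= eqxx orbT.
have [||z0 [z1 [ms' /= jz0 jz1]]] := side_max_segment (x := hi F i) (i := j) tT; first by rewrite /=; lra.
  by rewrite /on_line /= ij eqxx.
rewrite /xmeet in xij.
have [xz xz'] : x0 = z0 /\ x1 = z1 by apply: (max_segment_eq ms ms'); lra.
by exists (hi F i), x0, x1; split=> //=; rewrite ?xz ?xz' ?ij; try split; lra.
Qed.

(** At an abscissa common to [i] and [j], the tile directly below [j] can only lie above [i]. *)
Lemma above_lower i j : above_rel i j -> hi F i != lo F j ->
  exists k, above_rel i k /\ htouch k j.
Proof.
move=> /andP[yij /andP[xij xji]] ne; have [bi yi _] := tile_y tF i.
have [_ xi _] := tile_x tF i; have [_ xj _] := tile_x tF j.
have ltij : hi F i < lo F j by rewrite lt_neqAle ne.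
have [x [xi' xj']] : exists x, lf F i <= x < rg F i /\ lf F j <= x < rg F j.
  by have [h|h] := leP (lf F i) (lf F j); [exists (lf F j)|exists (lf F i)]; lra.
have [|k [xk kj]] := lower_tile xj'; first lra.
have xik : xmeet F i k by rewrite /xmeet; lra.
exists k; split; last by rewrite /htouch kj eqxx /xmeet; lra.
have ik : i != k by apply/eqP => ik; move: ltij; rewrite -kj ik ltxx.
rewrite /above_rel xik andbT; have [//|] := disj_y ik xik.
by have [_ yk _] := tile_y tF k; lra.
Qed.

(** If the heights differ, [above_lower] inserts a tile between; if they agree, no tile of positive
    height fits. Horizontal contacts thus follow from the above relation. *)
Lemma htouchE i j :
  htouch i j <-> above_rel i j /\ forall k, ~ (above_rel i k /\ above_rel k j).
Proof.
split=> [/andP[/eqP ij xij]|[aij cov]].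
  split; first by rewrite /above_rel ij lexx.
  by move=> k [/andP[ik _] /andP[kj _]]; have [_ yk _] := tile_y tF k; lra.
have [ij|/(above_lower aij)[k [aik /andP[/eqP kj xkj]]]] := eqVneq (hi F i) (lo F j).
  by case/andP: aij => _; rewrite /htouch ij eqxx.
by case: (cov k); rewrite /above_rel kj lexx.
Qed.

Lemma above_relE i j : clos_trans I (step (transpose F)) i j <-> above_rel i j.
Proof.
split=> [aij|].
  suff [? ? ?] : [/\ hi F i <= lo F j, lf F i <= lf F j & rg F j <= rg F i].
    have [_ xi _] := tile_x tF i; have [_ xj _] := tile_x tF j.
    by rewrite /above_rel /xmeet; lra.
  elim: aij => [{}i {}j /step_transpose_sub[-> ? ?] //|{}i k {}j _ [h1 h2 h3] _ [h4 h5 h6]].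
  by have [_ yk _] := tile_y tF k; split; lra.
have [m] := ubnP #|[pred k | lo F k < lo F j]|.
elim: m j => // m IH j; rewrite ltnS => jm aij.
have [ij|/(above_lower aij)[k [aik kj]]] := eqVneq (hi F i) (lo F j).
  by apply/t_step/step_transposeE; case/andP: aij => _; rewrite /htouch ij eqxx.
apply: t_trans (IH k _ aik) _; last exact/t_step/step_transposeE.
apply: leq_trans jm; have [_ yk _] := tile_y tF k; case/andP: kj => /eqP kj _.
apply: proper_card; apply/properP; split.
  by apply/fintype.subsetP => l; rewrite !inE => /lt_trans; apply; rewrite -kj.
by exists k; rewrite !inE ?ltxx // -kj.
Qed.

(** By [next_tile] some tile starts on the line where [i] ends. The equation is thereby expressed
    through two orders, which is how it transfers from one tiling to another. *)
Lemma right_cover i j :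
  rg F i = lf F j <-> right_rel i j /\ forall k, right_rel i k -> lf F j <= lf F k.
Proof.
rewrite /right_rel; split=> [-> //|[ij cov]]; apply/eqP; rewrite eq_le ij leNgt; apply/negP => lt.
have [_ xj bj] := tile_x tF j.
have [|k [ki _]] := @next_tile i; first lra.
by have := cov k; rewrite ki lexx => /(_ isT); lra.
Qed.

Lemma right_relE i j : clos_trans I (step F) i j <-> right_rel i j.
Proof.
split=> [|].
  elim=> [{}i {}j /stepE ij|{}i k {}j _ h1 _ h2]; first by rewrite /right_rel ij.
  by rewrite /right_rel in h1 h2 *; have [_ xk _] := tile_x tF k; lra.
have [m] := ubnP #|[pred k | rg F i < rg F k]|.
elim: m i => // m IH i; rewrite ltnS /right_rel => im; rewrite le_eqVlt => /predU1P[ij|ij].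
  exact/t_step/stepE.
have [_ xj bj] := tile_x tF j; have [_ yj hj] := tile_y tF j.
have [|k [ki kt]] := @next_tile i; first lra.
have [_ xk _] := tile_x tF k.
apply: t_trans (IH k _ _); first by apply/t_step/stepE.
  apply: leq_trans im; apply: proper_card; apply/properP; split.
    by apply/fintype.subsetP => l; rewrite !inE; apply: lt_trans; rewrite -ki.
  by exists k; rewrite !inE ?ltxx // -ki.
(* Otherwise [k], whose top is the top of the box, would straddle the line of the left side of
   [j]. *)
rewrite /right_rel leNgt; apply/negP => jk.
by have := cross_lf tF (i := j) (j := k); lra.
Qed.

End Relations.

(** * The code of a tiling *)

Section Code.
Context {R : realFieldType} {n : nat}.
Local Open Scope ring_scope.
Local Open Scope set_scope.
Implicit Types (F G : @frame R 'I_n) (i j k : 'I_n).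

Definition before F i j := (lf F i < lf F j) || (lf F i == lf F j) && (hi F j < hi F i).

Definition canonical F := forall i j, (i < j)%N -> before F i j.

Definition counted F i j := (rg F i < lf F j) || (rg F i == lf F j) && (lo F i < hi F j).

Definition code F j := #|[set i | counted F i j]|.

(* On canonical labels, the vertical order of tiles with overlapping x-ranges (lower_hi). *)
Definition lower F i k := (lf F i < lf F k) || (lf F i == lf F k) && (k < i)%N.

Lemma xmeet_same_lf F i j : tiling F -> lf F i = lf F j -> xmeet F i j.
Proof.
by move=> tF ij; have [_ xi _] := tile_x tF i; have [_ xj _] := tile_x tF j; rewrite /xmeet; lra.
Qed.

Lemma before_total F i j : top_tiling F -> i != j -> before F i j || before F j i.
Proof.
move=> tF ij; rewrite /before; case: (ltgtP (lf F i) (lf F j)) => //= e.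
have [_ yi _] := tile_y tF i; have [_ yj _] := tile_y tF j.
by have [] := disj_y tF ij (xmeet_same_lf tF e); lra.
Qed.

Lemma before_trans F : transitive (before F).
Proof.
move=> j i k /orP[ij|/andP[/eqP ij hij]] /orP[jk|/andP[/eqP jk hjk]]; apply/orP.
- by left; apply: lt_trans jk.
- by left; rewrite -jk.
- by left; rewrite ij.
by right; rewrite ij jk eqxx (lt_trans hjk).
Qed.

Lemma before_irr F i : before F i i = false.
Proof. by rewrite /before !ltxx andbF. Qed.

Lemma top_tiling_relabel I J (F : @frame R I) (s : J -> I) :
  bijective s -> top_tiling F -> top_tiling (relabel F s).
Proof.
case=> t st ts [[tx ty td tc] c1 c2 c3]; split=> [|i j|i j|i j]; [|exact: c1|exact: c2|exact: c3].
split=> [i|i|i j xij yij|x y xb yb]; [exact: tx|exact: ty| |].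
  exact/(can_inj st)/td.
by have [i [? ?]] := tc x y xb yb; exists (t i); rewrite /= ts.
Qed.

(** The label of a tile is the number of its predecessors in the total order [before]. *)
Lemma exists_canonical F : top_tiling F -> exists2 s : 'I_n -> 'I_n, bijective s & canonical (relabel F s).
Proof.
move=> tF; pose pre i := [set k | before F k i].
have pre_lt i : (#|pre i| < n)%N.
  rewrite -[n in (_ < n)%N]card_ord; apply: proper_card; apply/properP; split.
    exact/fintype.subsetP.
  by exists i; rewrite // inE before_irr.
pose rank i := Ordinal (pre_lt i).
have rank_mono i j : before F i j -> (rank i < rank j)%N.
  move=> ij; apply: proper_card; apply/properP; split.
    by apply/fintype.subsetP => k; rewrite !inE => /before_trans; apply.
  by exists i; rewrite !inE ?before_irr.
have rank_inj : injective rank.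
  move=> i j ij; apply/eqP; apply: contraT => /(before_total tF) /orP[] /rank_mono;
  by rewrite ij ltnn.
have [s rs sr] := injF_bij rank_inj.
exists s; first by exists rank.
move=> i j; rewrite -{1}[i]sr -{1}[j]sr => ij.
have ne : s i != s j by apply/eqP => e; move: ij; rewrite e ltnn.
have /orP[//|/rank_mono ji] := before_total tF ne.
by move: (ltn_trans ij ji); rewrite ltnn.
Qed.

Lemma card_lt_ord i : #|[set k : 'I_n | (k < i)%N]| = i.
Proof.
have wi : injective (widen_ord (ltnW (ltn_ord i))).
  by move=> k l /(congr1 val) /= /val_inj.
rewrite -[RHS]card_ord -(card_codom wi); apply: eq_card => k; rewrite inE.
apply/idP/codomP => [ki|[l ->]]; last exact: (ltn_ord l).
by exists (Ordinal ki); apply: val_inj.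
Qed.

Lemma counted_lf F i j : tiling F -> counted F i j -> lf F i < lf F j.
Proof.
by move=> tF; have [_ xi _] := tile_x tF i; rewrite /counted; case/orP=> [|/andP[/eqP]]; lra.
Qed.

Lemma counted_right F i j : counted F i j -> right_rel F i j.
Proof. by rewrite /right_rel => /orP[/ltW //|/andP[/eqP-> _]]. Qed.

Section Canonical.
Variable F : @frame R 'I_n.
Hypotheses (tF : top_tiling F) (cF : canonical F).

Lemma canonical_le i j : (i <= j)%N -> lf F i <= lf F j.
Proof.
rewrite leq_eqVlt => /predU1P[/val_inj-> //|/cF /orP[/ltW //|/andP[/eqP-> _]]]; exact: lexx.
Qed.

Lemma canonical_lt i j : lf F i < lf F j -> (i < j)%N.
Proof. by rewrite ltNge ltnNge => /negP h; apply/negP => /canonical_le. Qed.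

Lemma code_le j : (code F j <= j)%N.
Proof.
rewrite -[leqRHS]card_lt_ord; apply: subset_leq_card; apply/fintype.subsetP => i.
by rewrite !inE => /(counted_lf tF)/canonical_lt.
Qed.

Lemma left_neighbour j : box_lf F < lf F j ->
  exists k, [/\ rg F k = lf F j, lo F k <= lo F j & lo F j < hi F k].
Proof.
move=> bj; have [_ xj jb] := tile_x tF j; have [bj' yj jb'] := tile_y tF j.
have [||k [xk yk]] := corner_mp tF (x := lf F j) (y := lo F j); try lra.
exists k; split; try lra.
apply/eqP; rewrite eq_le; have [_ ->] := andP xk; rewrite andbT leNgt; apply/negP => ltx.
by have := cross_lf tF (i := j) (j := k); lra.
Qed.

(** Every tile counted for [i] ends strictly left of [j], and the tile at the left of the lower left
    corner of [j] is counted for [j] only. *)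
Lemma code_lt i j : lf F i < lf F j -> (code F i < code F j)%N.
Proof.
move=> ij; have [bi _ _] := tile_x tF i; have [_ yj _] := tile_y tF j.
have [|k [kj klo _]] := @left_neighbour j; first lra.
apply: proper_card; apply/properP; split.
  apply/fintype.subsetP => l; rewrite !inE => /counted_right; rewrite /right_rel => li.
  by apply/orP; left; lra.
by exists k; rewrite !inE /counted kj ?eqxx /=; lra.
Qed.

(** Tops descend along a column, so the height condition in [counted] becomes harder. *)
Lemma code_ge i j : lf F i = lf F j -> (i <= j)%N -> (code F j <= code F i)%N.
Proof.
move=> ij; rewrite leq_eqVlt => /predU1P[/val_inj-> //|/cF].
rewrite /before ij ltxx eqxx /= => hji; apply: subset_leq_card; apply/fintype.subsetP => l.
by rewrite !inE /counted ij => /orP[->//|/andP[-> h]]; rewrite (lt_trans h) ?orbT.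
Qed.

Lemma lf_code i j : (lf F i < lf F j) = (i < j)%N && (code F i < code F j)%N.
Proof.
apply/idP/andP => [ij|[ij cij]]; first by rewrite canonical_lt ?code_lt.
rewrite lt_neqAle canonical_le ?(ltnW ij) // andbT; apply/eqP => e.
by have := code_ge e (ltnW ij); rewrite leqNgt cij.
Qed.

Lemma lf_code_eq i j : (lf F i == lf F j) =
  ~~ ((i < j)%N && (code F i < code F j)%N) && ~~ ((j < i)%N && (code F j < code F i)%N).
Proof. by rewrite -!lf_code; case: ltgtP. Qed.

Lemma lower_total i k : i != k -> lower F i k || lower F k i.
Proof.
rewrite /lower -(inj_eq val_inj) /= neq_ltn.
by case: (ltgtP (lf F i) (lf F k)) => //= _; rewrite orbC.
Qed.

(** If [k] starts inside the x-range of [i], the segment at its left side runs to the top and [i]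
    must end below it; within a column, larger labels lie lower. *)
Lemma lower_hi i k : lower F i k -> lf F k < rg F i -> hi F i <= lo F k.
Proof.
move=> /orP[ik|/andP[/eqP ik ki]] ki'; first by apply: cross_lf; rewrite ?ik.
have [_ yi _] := tile_y tF i; have [_ yk _] := tile_y tF k.
have := cF ki; rewrite /before ik ltxx eqxx /= => hik.
have ne : i != k by rewrite -(inj_eq val_inj) gtn_eqF.
by have [] := disj_y tF ne (xmeet_same_lf tF ik); lra.
Qed.

Lemma above_lowerE i j :
  above_rel F i j = [&& i != j, lower F i j, ~~ right_rel F i j & ~~ right_rel F j i].
Proof.
have [_ yi _] := tile_y tF i; have [_ yj _] := tile_y tF j.
rewrite /above_rel /xmeet /right_rel -!ltNge; apply/idP/idP => [|/and4P[ne ij xj xi]].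
  move=> /and3P[yij xi xj]; rewrite xi xj !andbT.
  have ne : i != j by apply/eqP => e; move: yij; rewrite e; lra.
  rewrite ne /=; have /orP[//|ji] := lower_total ne.
  by have := lower_hi ji xi; lra.
by rewrite lower_hi // xi xj.
Qed.

End Canonical.
End Code.

(** * The code determines the strong class *)

(** Up-sets of a total order are nested, so equal size forces equality. *)
Lemma upset_eq (T : finType) (r : rel T) (E A B : {set T}) :
  {in E &, forall x y, x != y -> r x y || r y x} ->
  (A \subset E)%SET -> (B \subset E)%SET ->
  (forall x y, x \in A -> y \in E -> r x y -> y \in A) ->
  (forall x y, x \in B -> y \in E -> r x y -> y \in B) ->
  #|A| = #|B| -> A = B.
Proof.
move=> tot /fintype.subsetP AE /fintype.subsetP BE upA upB cAB.
have [AB|/fintype.subsetPn[x xA xB]] := boolP (A \subset B)%SET.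
  by apply/eqP; rewrite eqEcard AB cAB leqnn.
apply/esym/eqP; rewrite eqEcard cAB leqnn andbT; apply/fintype.subsetP => y yB.
have xy : x != y by apply: contraNneq xB => ->.
have /orP[xy'|yx] := tot x y (AE _ xA) (BE _ yB) xy.
  exact: upA xA (BE _ yB) xy'.
by move: xB; rewrite (upB _ _ yB (AE _ xA) yx).
Qed.

Section CodeDetermines.
Context {R : realFieldType} {n : nat}.
Local Open Scope ring_scope.
Local Open Scope set_scope.
Implicit Types (F G : @frame R 'I_n) (i j k : 'I_n).

(** In both disjuncts the increase of the code puts [k] in a later column than [i], which
    contradicts [z <= x]. *)
Lemma code_bad1 F i j k : top_tiling F -> canonical F -> (i < j < k)%N ->
  ~~ bad1 (code F i) (code F j) (code F k).
Proof.
move=> tF cF /andP[ij jk]; have lfc := lf_code tF cF.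
have := canonical_le cF (ltnW ij); have := canonical_le cF (ltnW jk) => ljk lij.
rewrite /bad1 negb_or; apply/andP; split; apply/negP => /andP[h1 h2].
  have lt : lf F i < lf F j by rewrite lfc ij h1.
  by have := code_lt tF (lt_le_trans lt ljk); rewrite ltnNge h2.
have lt : lf F j < lf F k by rewrite lfc jk h1.
by have := code_lt tF (le_lt_trans lij lt); rewrite ltnNge h2.
Qed.

Lemma right_rel_lt F i j : top_tiling F -> canonical F -> right_rel F i j -> (i < j)%N.
Proof.
move=> tF cF ij; apply: (canonical_lt cF); have [_ xi _] := tile_x tF i.
exact: lt_le_trans ij.
Qed.

Lemma column_top F j : top_tiling F -> canonical F ->
  (forall i, (i < j)%N -> lf F i < lf F j) -> hi F j = box_hi F.
Proof.
move=> tF cF jmin; have [bj xj jb] := tile_x tF j; have [bj' yj jb'] := tile_y tF j.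
have [||k [xk yk]] := corner_pm tF (x := lf F j) (y := box_hi F); try lra.
have [_ _ kb] := tile_y tF k.
have kj : lf F k = lf F j.
  apply/eqP; rewrite eq_le; have [-> _] := andP xk; rewrite /= leNgt; apply/negP => ltx.
  by have := cross_lf tF (i := j) (j := k); lra.
case: (ltngtP k j) => [/jmin|/cF|/val_inj <-]; rewrite ?kj ?ltxx //; last lra.
by rewrite /before kj ltxx eqxx /=; lra.
Qed.

Lemma code_column_top F j : tiling F -> hi F j = box_hi F ->
  code F j = #|[set i | right_rel F i j]|.
Proof.
move=> tF jt; apply: eq_card => i; rewrite !inE /counted /right_rel jt le_eqVlt orbC.
by have [_ yi yb] := tile_y tF i; rewrite (lt_le_trans yi yb) andbT.
Qed.

(** If a tile still open at the column of [p] ends by the column of [j], the segment at its right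
    side runs to the top, so the open tiles above it cannot continue beyond. *)
Lemma right_rel_upset F (p j : 'I_n) i k : top_tiling F -> canonical F ->
  lf F p < lf F j -> (i <= p)%N -> (k <= p)%N -> ~~ right_rel F i p -> ~~ right_rel F k p ->
  lower F i k -> right_rel F i j -> right_rel F k j.
Proof.
rewrite /right_rel -!ltNge => tF cF pj ip kp lip lkp ik ij.
have li := canonical_le cF ip; have lk := canonical_le cF kp.
rewrite leNgt; apply/negP => jk.
have [_ yi _] := tile_y tF i; have [_ yk _] := tile_y tF k.
have := cross_rg tF (i := i) (j := k); have := lower_hi tF cF ik.
by lra.
Qed.

Lemma lo_hi_downset F j i k : top_tiling F -> canonical F ->
  rg F i = lf F j -> rg F k = lf F j -> lower F k i -> lo F i < hi F j -> lo F k < hi F j.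
Proof.
move=> tF cF ij kj ki; have [_ xi _] := tile_x tF i; have [_ yk _] := tile_y tF k.
by have := lower_hi tF cF ki; lra.
Qed.

(** This comparison is not counted by the code but is needed for contact. With [k] the tile on top
    of [i] and [l] the one beneath [j] along the common line, [lo F k = hi F i] and
    [hi F l = lo F j], so only a comparison of the counted kind remains. *)
Lemma hi_loE F i j : top_tiling F -> canonical F -> rg F i = lf F j ->
  (hi F i <= lo F j) = [exists k, exists l,
    [&& rg F k == lf F j, lower F i k, lf F l == lf F j, (j < l)%N & lo F k < hi F l]].
Proof.
move=> tF cF ij; have [bi xi _] := tile_x tF i; have [_ xj jb] := tile_x tF j.
have [bi' yi _] := tile_y tF i; have [_ yj jb'] := tile_y tF j.
apply/idP/existsP => [hij|[k /existsP[l /and5P[/eqP kj ik /eqP lj jl kl]]]]; last first.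
  have [_ xk _] := tile_x tF k.
  have := lower_hi tF cF (i := j) (k := l); have := lower_hi tF cF ik.
  have lowlj : lower F l j by rewrite /lower lj eqxx jl orbT.
  by have := lower_hi tF cF lowlj; have [_ xl _] := tile_x tF l; lra.
have [||k [xk yk]] := corner_mp tF (x := lf F j) (y := hi F i); try lra.
have [||l [xl yl]] := corner_pm tF (x := lf F j) (y := lo F j); try lra.
have kj : rg F k = lf F j.
  apply/eqP; rewrite eq_le; have [_ ->] := andP xk; rewrite andbT leNgt; apply/negP => ltx.
  by have := cross_rg tF (i := i) (j := k); lra.
have lj : lf F l = lf F j.
  apply/eqP; rewrite eq_le; have [-> _] := andP xl; rewrite /= leNgt; apply/negP => ltx.
  by have := cross_rg tF (i := i) (j := l); lra.
have ik : i != k by apply/eqP => ik; move: yk; rewrite -ik; lra.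
have jl : j != l by apply/eqP => jl; move: yl; rewrite -jl; lra.
have [_ xl' _] := tile_x tF l; have [_ yk' _] := tile_y tF k.
have [_ xk' _] := tile_x tF k; have [_ yl' _] := tile_y tF l.
have xik : xmeet F i k by rewrite /xmeet; lra.
have xjl : xmeet F j l by rewrite /xmeet; lra.
have hik : hi F i <= lo F k by case: (disj_y tF ik xik); lra.
have hlj : hi F l <= lo F j by case: (disj_y tF jl xjl); lra.
exists k; apply/existsP; exists l; rewrite kj lj !eqxx /=; apply/and3P; split.
- have /orP[//|ki] := lower_total F ik.
  by have := lower_hi tF cF ki; lra.
- by case: (ltngtP j l) => [//|/cF|/val_inj/eqP]; rewrite ?(negbTE jl) // /before lj ltxx; lra.
(* A tie would make the tops of [i] and [l] join below the top of the box. *)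
have := no_corner tF (i := i) (j := l); lra.
Qed.

Lemma rg_lf_eq F G : top_tiling F -> top_tiling G ->
  (forall i j, right_rel F i j = right_rel G i j) ->
  (forall i j, (lf F i <= lf F j) = (lf G i <= lf G j)) ->
  forall i j, (rg F i == lf F j) = (rg G i == lf G j).
Proof.
move=> tF tG rE lE i j; apply/eqP/eqP => /right_cover[//|ij cov]; apply/right_cover => //.
  by split=> [|k]; rewrite -rE // -lE; apply: cov.
by split=> [|k]; rewrite rE // lE; apply: cov.
Qed.

(** * Recovering the relations of a tiling from its code *)

Section SameCode.
Variables F G : @frame R 'I_n.
Hypotheses (tF : top_tiling F) (cF : canonical F) (tG : top_tiling G) (cG : canonical G).
Hypothesis codeE : code F =1 code G.

Let lfE i j : (lf F i < lf F j) = (lf G i < lf G j).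
Proof. by rewrite !lf_code ?codeE. Qed.

Let lf_eqE i j : (lf F i == lf F j) = (lf G i == lf G j).
Proof. by rewrite !lf_code_eq ?codeE. Qed.

Let lowerE i j : lower F i j = lower G i j.
Proof. by rewrite /lower lfE lf_eqE. Qed.

(** Induction over labels. Within a column nothing changes. The first tile of a new column reaches
    the top, so its code is the number of all tiles closed by then; the newly closed ones form an
    up-set of the open ones and are fixed by their number. *)
Lemma right_rel_code i j : right_rel F i j = right_rel G i j.
Proof.
have [m] := ubnP (j : nat); elim: m i j => // m IH i [j jn] /=; rewrite ltnS => jm.
case: j jn jm => [|p] jn jm.
  by apply/idP/idP => /right_rel_lt => [/(_ tF cF)|/(_ tG cG)].
set j := Ordinal jn; pose q : 'I_n := Ordinal (ltnW jn).
have IHq k : right_rel F k q = right_rel G k q by apply: IH.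
have qj : (q <= j)%N by rewrite /= leqnSn.
have [lqj|ljq] := ltP (lf F q) (lf F j); last first.
  have e : lf F q = lf F j by apply/le_anti; rewrite (canonical_le cF qj).
  have e' : lf G q = lf G j by apply/eqP; rewrite -lf_eqE e.
  by move: (IHq i); rewrite /right_rel e e'.
have lqj' : lf G q < lf G j by rewrite -lfE.
pose rights (H : @frame R 'I_n) l := [set k | right_rel H k l].
have sub H : lf H q < lf H j -> rights H q \subset rights H j.
  by move=> lH; apply/fintype.subsetP => k; rewrite !inE => /le_trans; apply; apply: ltW.
have rq : rights F q = rights G q by apply/setP => k; rewrite !inE IHq.
have card H : top_tiling H -> canonical H -> lf H q < lf H j ->
    (#|rights H q| + #|rights H j :\: rights H q|)%N = code H j.
  move=> tH cH lH; rewrite (code_column_top tH).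
    by rewrite -(cardsID (rights H q) (rights H j)) (finset.setIidPr (sub _ lH)).
  apply: column_top => // k kj; apply: le_lt_trans lH; exact: canonical_le.
pose E := [set k : 'I_n | (k < j)%N] :\: rights F q.
have inE' H : top_tiling H -> canonical H -> rights H q = rights F q ->
    rights H j :\: rights H q \subset E.
  move=> tH cH ->; apply/finset.setSD/fintype.subsetP => k; rewrite !inE; exact: right_rel_lt.
have up H : top_tiling H -> canonical H -> lf H q < lf H j -> rights H q = rights F q ->
    lower H =2 lower F ->
    forall x y, x \in rights H j :\: rights H q -> y \in E -> lower F x y ->
    y \in rights H j :\: rights H q.
  move=> tH cH lH rH lowH x y; rewrite /E -rH !inE => /andP[nxq xj] /andP[nyq yj] lxy.
  rewrite nyq /=; apply: (right_rel_upset tH cH lH _ _ nxq nyq _ xj); last by rewrite lowH.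
    by have := right_rel_lt tH cH xj; rewrite ltnS.
  by move: yj; rewrite ltnS.
have eqA : rights F j :\: rights F q = rights G j :\: rights G q.
  apply: (upset_eq (r := lower F) (E := E)).
  - by move=> x y _ _; apply: lower_total.
  - exact: inE'.
  - exact: inE'.
  - exact: up.
  - by apply: up => // x y; rewrite lowerE.
  by apply/eqP; rewrite -(eqn_add2l #|rights F q|) card // rq card // codeE.
have := sub F lqj; have := sub G lqj'.
move=> /fintype.subsetP/(_ i) sG /fintype.subsetP/(_ i) sF.
move/setP/(_ i): eqA; rewrite !inE in sG sF *; rewrite IHq in sF *.
by case: (right_rel G i q) sG sF => //= sG sF _; rewrite sG ?sF.
Qed.

Lemma above_rel_code i j : above_rel F i j = above_rel G i j.
Proof. by rewrite !above_lowerE // lowerE !right_rel_code. Qed.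

Let rgE i j : (rg F i == lf F j) = (rg G i == lf G j).
Proof.
apply: rg_lf_eq; rewrite // => {}i {}j; [exact: right_rel_code|].
by rewrite !leNgt lfE.
Qed.

(** Subtracting the tiles closed before the line of [j], which are already known, the code leaves
    the number of counted tiles ending on that line. They are the lowest ones there, so their number
    determines them. *)
Lemma lo_hi_code i j : rg F i = lf F j -> (lo F i < hi F j) = (lo G i < hi G j).
Proof.
move=> ij; pose S (H : @frame R 'I_n) := [set k | (rg H k == lf H j) && (lo H k < hi H j)].
pose L (H : @frame R 'I_n) := [set k | rg H k < lf H j].
have cardS H : (#|L H| + #|S H|)%N = code H j.
  rewrite /code -(cardsID (L H) [set i | counted H i j]); congr (_ + _)%N; apply: eq_card => k; rewrite !inE /counted;
    by case: (ltgtP (rg H k) (lf H j)); rewrite ?andbF ?andbT.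
have LE : L F = L G.
  by apply/setP => k; rewrite !inE !lt_neqAle rgE; have := right_rel_code k j; rewrite /right_rel => ->.
have SE : S F = S G.
  apply: (upset_eq (r := fun x y => lower F y x) (E := [set k | rg F k == lf F j])).
  - by move=> x y _ _ xy; rewrite orbC; apply: lower_total.
  - by apply/fintype.subsetP => k; rewrite !inE => /andP[].
  - by apply/fintype.subsetP => k; rewrite !inE rgE => /andP[].
  - move=> x y; rewrite !inE => /andP[/eqP xj hx] /eqP yj yx.
    by rewrite yj eqxx (lo_hi_downset tF cF xj yj yx).
  - move=> x y; rewrite !inE rgE lowerE => /andP[/eqP xj hx] /eqP yj yx.
    by rewrite yj eqxx (lo_hi_downset tG cG xj yj yx).
  by apply/eqP; rewrite -(eqn_add2l #|L F|) cardS LE cardS codeE.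
by move/setP/(_ i): SE; rewrite !inE -rgE ij eqxx.
Qed.

Lemma vtouch_code i j : vtouch F i j = vtouch G i j.
Proof.
rewrite /vtouch /ymeet -rgE; case: eqP => //= ij; rewrite (lo_hi_code ij); congr (_ && _).
have ij' : rg G i = lf G j by apply/eqP; rewrite -rgE ij.
rewrite !ltNge !hi_loE //; congr (~~ _).
apply: eq_existsb => k; apply: eq_existsb => l; rewrite -rgE -lowerE -lf_eqE.
case: eqP => //= kj; case: eqP => //= lj; by rewrite lo_hi_code ?kj ?lj.
Qed.

Lemma htouch_code i j : htouch F i j = htouch G i j.
Proof.
apply/idP/idP => /htouchE [//|a cov]; apply/htouchE => //; split.
- by rewrite -above_rel_code.
- by move=> k; rewrite -!above_rel_code.
- by rewrite above_rel_code.
by move=> k; rewrite !above_rel_code.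
Qed.

Lemma touch_code i j : touch F i j = touch G i j.
Proof. by rewrite /touch !vtouch_code !htouch_code. Qed.

End SameCode.

(** By [prev_tile], every left side off the left side of the box is on the line of some right side,
    so [right_rel] determines the order of left sides. *)
Lemma lf_leE F i j : top_tiling F ->
  lf F i <= lf F j <-> forall k, right_rel F k i -> right_rel F k j.
Proof.
move=> tF; rewrite /right_rel; split=> [ij k ki|h]; first exact: le_trans ij.
rewrite leNgt; apply/negP => ji; have [bj _ _] := tile_x tF j.
have [|k [ki _]] := prev_tile tF (j := i); first lra.
by have := h k; rewrite ki lexx => /(_ isT); lra.
Qed.

(** The numbering order depends only on the two order relations, so a strong equivalence preserves
    it. *)
Lemma beforeE F i j : top_tiling F ->
  before F i j = ~~ (lf F j <= lf F i) || (lf F i <= lf F j) && (lf F j <= lf F i) && above_rel F j i.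
Proof.
move=> tF; rewrite /before -ltNge -eq_le; case: eqP => //= ij.
rewrite ij ltxx /=; have [_ yi _] := tile_y tF i; have [_ yj _] := tile_y tF j.
rewrite /above_rel (xmeet_same_lf tF (esym ij)) andbT; apply/idP/idP => [hji|]; last lra.
have ne : i != j by apply/eqP => e; move: hji; rewrite e ltxx.
by have [] := disj_y tF ne (xmeet_same_lf tF ij); lra.
Qed.

(** Here the counted comparison is expressed through contacts, the part of strong equivalence that
    the two orders do not supply. The witness is the tile at the right of the lower right corner of
    [i]. *)
Lemma lo_hiE F i j : top_tiling F -> rg F i = lf F j ->
  lo F i < hi F j <->
  exists k, [/\ touch F i k, lf F k = lf F j & k = j \/ above_rel F k j].
Proof.
move=> tF ij; have [_ xi _] := tile_x tF i; have [bj xj jb] := tile_x tF j.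
have [bi yi ib] := tile_y tF i; have [_ yj jb'] := tile_y tF j.
split=> [lij|[k [tik kj kj']]].
  have [||k [xk yk]] := corner_pp tF (x := lf F j) (y := lo F i); try lra.
  have kj : lf F k = lf F j.
    apply/eqP; rewrite eq_le; have [-> _] := andP xk; rewrite /= leNgt; apply/negP => ltx.
    by have := cross_rg tF (i := i) (j := k); lra.
  exists k; split=> //; first by rewrite /touch /vtouch /ymeet ij kj eqxx /=; lra.
  have [->|ne] := eqVneq k j; [by left|right].
  by rewrite /above_rel (xmeet_same_lf tF kj) andbT; have [] := disj_y tF ne (xmeet_same_lf tF kj); lra.
have [_ xk _] := tile_x tF k; have [_ yk _] := tile_y tF k.
have hkj : hi F k <= hi F j by case: kj' => [->//|/andP[? _]]; lra.
case/or4P: tik => /andP[/eqP e]; rewrite /ymeet /xmeet; lra.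
Qed.

Lemma mono_ord_id (f : 'I_n -> 'I_n) : bijective f ->
  (forall i j, (f i < f j)%N = (i < j)%N) -> f =1 id.
Proof.
move=> fb fm i; apply: val_inj; rewrite /= -[LHS]card_lt_ord -[RHS]card_lt_ord.
rewrite -[RHS](card_imset _ (bij_inj fb)); apply: eq_card => k; have [g gf fg] := fb.
by rewrite -(fg k) (mem_imset _ _ (bij_inj fb)) !inE fm.
Qed.

(** The bijection preserves [before], so on canonical labels it is the identity; each condition in
    [counted] is then a statement about preserved relations. *)
Lemma iso_code F G (phi : 'I_n -> 'I_n) :
  top_tiling F -> canonical F -> top_tiling G -> canonical G -> bijective phi ->
  (forall i j, right_rel F i j = right_rel G (phi i) (phi j)) ->
  (forall i j, above_rel F i j = above_rel G (phi i) (phi j)) ->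
  (forall i j, touch F i j = touch G (phi i) (phi j)) ->
  code F =1 code G.
Proof.
move=> tF cF tG cG phib rE aE tE; have [psi pk kp] := phib.
have lfE i j : (lf F i <= lf F j) = (lf G (phi i) <= lf G (phi j)).
  apply/idP/idP => /lf_leE h; apply/lf_leE => // k.
    by rewrite -(kp k) -!rE; apply: h.
  by rewrite !rE; apply: h.
have canE (H : @frame R 'I_n) : top_tiling H -> canonical H -> forall i j, before H i j = (i < j)%N.
  move=> tH cH i j; apply/idP/idP => [ij|/cH //]; rewrite ltnNge leq_eqVlt.
  apply/negP => /predU1P[/val_inj e|/cH ji]; first by move: ij; rewrite e before_irr.
  by have := before_trans ij ji; rewrite before_irr.
have phi_id : phi =1 id.
  by apply: mono_ord_id => // i j; rewrite -(canE _ tG cG) -(canE _ tF cF) !beforeE // !lfE aE.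
have {}rE i j : right_rel F i j = right_rel G i j by rewrite rE !phi_id.
have {}aE i j : above_rel F i j = above_rel G i j by rewrite aE !phi_id.
have {}tE i j : touch F i j = touch G i j by rewrite tE !phi_id.
have {}lfE i j : (lf F i <= lf F j) = (lf G i <= lf G j) by rewrite lfE !phi_id.
have rgE i j : (rg F i == lf F j) = (rg G i == lf G j).
  exact: rg_lf_eq.
have lf_eqE i j : lf F i = lf F j <-> lf G i = lf G j.
  by split=> e; apply/eqP; rewrite eq_le; [rewrite -!lfE|rewrite !lfE]; rewrite e lexx.
move=> j; apply: eq_card => i; rewrite !inE /counted !lt_neqAle !rgE.
have -> : (rg F i <= lf F j) = (rg G i <= lf G j) by exact: rE.
congr (_ || _); case: eqP => //= ij; have ij' : rg F i == lf F j by rewrite rgE ij.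
rewrite -!lt_neqAle; apply/idP/idP => [/(lo_hiE tF (eqP ij'))|/(lo_hiE tG ij)] [k [t l a]].
  by apply/(lo_hiE tG ij); exists k; rewrite -tE -aE; split=> //; apply/lf_eqE.
by apply/(lo_hiE tF (eqP ij')); exists k; rewrite tE aE; split=> //; apply/lf_eqE.
Qed.

End CodeDetermines.

(** * Adding a tile *)

Section OrderStatistic.
Context {R : realFieldType} (T : finType).
Local Open Scope ring_scope.
Local Open Scope set_scope.

(** The rank is injective on [E] with values below [#|E|], so it takes every such value. *)
Lemma order_statistic (E : {set T}) (f : T -> R) (k : nat) :
  {in E &, injective f} -> (k < #|E|)%N ->
  exists2 u, u \in E & #|[set i in E | f i < f u]| = k.
Proof.
move=> fi kE; pose rank u := #|[set i in E | f i < f u]|.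
have rank_lt u v : u \in E -> f u < f v -> (rank u < rank v)%N.
  move=> uE uv; apply: proper_card; apply/properP; split.
    by apply/fintype.subsetP => i; rewrite !inE => /andP[-> /lt_trans]; apply.
  by exists u; rewrite !inE uE ?ltxx.
have rank_inj : {in E &, injective rank}.
  move=> u v uE vE e; apply: fi => //.
  by have [h|h|//] := ltgtP (f u) (f v);
    [have := rank_lt _ _ uE h|have := rank_lt _ _ vE h]; rewrite e ltnn.
have un : uniq [seq rank u | u <- enum E].
  by rewrite map_inj_in_uniq ?enum_uniq // => u v; rewrite !mem_enum; apply: rank_inj.
have sub : {subset [seq rank u | u <- enum E] <= iota 0 #|E|}.
  move=> m /mapP[u]; rewrite mem_enum mem_iota => uE ->; rewrite add0n /=.
  apply: proper_card; apply/properP; split.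
    by apply/fintype.subsetP => i; rewrite !inE => /andP[].
  by exists u; rewrite // !inE ltxx andbF.
have [|_ /(_ k)] := uniq_min_size un sub; first by rewrite size_map size_iota -cardE.
rewrite mem_iota add0n kE => /mapP[u]; rewrite mem_enum => uE ->; by exists u.
Qed.

End OrderStatistic.

Section Construction.
Context {R : realFieldType} {n : nat}.
Local Open Scope ring_scope.
Local Open Scope set_scope.
Implicit Types (F : @frame R 'I_n.+1).

Definition extend T (f : 'I_n.+1 -> T) (c : T) (i : 'I_n.+2) : T :=
  if unlift ord_max i is Some j then f j else c.

Lemma extend_lift T (f : 'I_n.+1 -> T) c j : extend f c (lift ord_max j) = f j.
Proof. by rewrite /extend liftK. Qed.

Lemma extend_max T (f : 'I_n.+1 -> T) c : extend f c ord_max = c.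
Proof. by rewrite /extend unlift_none. Qed.

Lemma ord_max_ind (P : 'I_n.+2 -> Prop) :
  (forall j, P (lift ord_max j)) -> P ord_max -> forall i, P i.
Proof. by move=> Pj Pm i; case: (unliftP ord_max i) => [j ->|->]. Qed.

Lemma card_ord_recr (P : pred 'I_n.+2) :
  #|[set i | P i]| = (#|[set j | P (lift ord_max j)]| + P ord_max)%N.
Proof.
rewrite -!sum1dep_card big_mkcond big_ord_recr /= [in RHS]big_mkcond /=; congr (_ + _)%N.
apply: eq_bigr => j _; rewrite (_ : widen_ord _ _ = lift ord_max j) //.
by apply: val_inj; rewrite /= /bump leqNgt ltn_ord.
Qed.

Lemma card_setC_ord (A : {set 'I_n.+1}) : #|~: A| = (n.+1 - #|A|)%N.
Proof. by rewrite finset.cardsCs finset.setCK card_ord. Qed.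

Lemma last_column F i : canonical F -> lf F i <= lf F ord_max.
Proof. by move=> cF; apply: canonical_le => //; rewrite -ltnS. Qed.

Lemma rg_last F i : top_tiling F -> canonical F -> rg F i <= lf F ord_max \/ rg F i = box_rg F.
Proof.
move=> tF cF; have [_ xi ib] := tile_x tF i; have [?|h] := eqVneq (rg F i) (box_rg F); first by right.
left; have [|k [<- _]] := next_tile tF (i := i); first by rewrite lt_neqAle h.
exact: last_column.
Qed.

Lemma rg_max F : top_tiling F -> canonical F -> rg F ord_max = box_rg F.
Proof.
by move=> tF cF; have [_ xi ib] := tile_x tF ord_max; have [|//] := rg_last ord_max tF cF; lra.
Qed.

Section AddColumn.
Variables (F : @frame R 'I_n.+1) (u : 'I_n.+1).
Hypotheses (tF : top_tiling F) (cF : canonical F) (uX : rg F u = box_rg F).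

Let kept i := (rg F i == box_rg F) && (lo F i < lo F u).
Let rg' i := if kept i then box_rg F + 1 else rg F i.

(** A strip of width 1 is added on the right. Open tiles below [u] are prolonged through it, [u] and
    the open tiles above it stop, and the new tile fills the strip from the bottom of [u] to the
    top. *)
Definition add_column := Frame
  (extend (lf F) (box_rg F)) (extend rg' (box_rg F + 1))
  (extend (lo F) (lo F u)) (extend (hi F) (box_hi F))
  (box_lf F) (box_rg F + 1) (box_lo F) (box_hi F).

Let keptP i : kept i -> [/\ rg F i = box_rg F, rg' i = box_rg F + 1 & hi F i <= lo F u].
Proof.
rewrite /rg' => ki; rewrite ki; move: ki => /andP[/eqP iX iu]; split=> //.
have [_ xi _] := tile_x tF i; have [_ xu _] := tile_x tF u; have [_ yu _] := tile_y tF u.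
have ne : i != u by apply/eqP => e; move: iu; rewrite e ltxx.
have uX' := uX; have xiu : xmeet F i u by rewrite /xmeet; lra.
by case: (disj_y tF ne xiu); lra.
Qed.

Let not_kept i : ~~ kept i -> rg' i = rg F i /\ (rg F i < box_rg F \/ lo F u <= lo F i).
Proof.
move=> ki; rewrite /rg' (negbTE ki); split=> //; move: ki; rewrite /kept negb_and -leNgt.
have [_ _ ib] := tile_x tF i.
by case/orP=> [h|]; [left; rewrite lt_neqAle h|right].
Qed.

Let rgP i : (rg' i = box_rg F + 1 /\ rg F i = box_rg F /\ hi F i <= lo F u) \/
  (rg' i = rg F i /\ (rg F i < box_rg F \/ lo F u <= lo F i)).
Proof. by have [/keptP[]|/not_kept[]] := boolP (kept i); [left|right]. Qed.

Lemma add_column_tiling : top_tiling add_column.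
Proof.
have uX' := uX; have [bu xu ub] := tile_x tF u; have [bu' yu ub'] := tile_y tF u.
have xm i j : lf F i < rg' j -> lf F i < rg F j.
  by have [_ xi ib] := tile_x tF i; have [[-> [-> _]]|[-> _]] := rgP j; lra.
split; [split| | |].
- apply: ord_max_ind => [j|] /=; rewrite ?extend_lift ?extend_max; last by split; lra.
  by have [? ? ?] := tile_x tF j; have [[-> [? _]]|[-> _]] := rgP j; split; lra.
- apply: ord_max_ind => [j|] /=; rewrite ?extend_lift ?extend_max; last by split; lra.
  exact: (tile_y tF).
- apply: ord_max_ind => [i|]; apply: ord_max_ind => [j|] //;
    rewrite /xmeet /ymeet /= ?extend_lift ?extend_max.
  + move=> /andP[xij xji] yij; congr lift; apply: (tile_disj tF) => //.
    by rewrite /xmeet !xm.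
  + move=> xiu yiu; exfalso; move: xiu yiu; have [_ _ ib] := tile_x tF i.
    by have [[-> [? ?]]|[-> ?]] := rgP i; lra.
  move=> xju yju; exfalso; move: xju yju; have [_ _ jb] := tile_x tF j.
  by have [[-> [? ?]]|[-> ?]] := rgP j; lra.
- move=> x y /= xb yb; have [xX|xX] := leP x (box_rg F).
    have [||i [xi yi]] := tile_cov tF (x := x) (y := y); try lra.
    exists (lift ord_max i); rewrite !extend_lift; split=> //.
    by have [[-> [? ?]]|[-> ?]] := rgP i; lra.
  have [uy|yu'] := leP (lo F u) y; first by exists ord_max; rewrite !extend_max; lra.
  have [||i [xi yi]] := tile_cov tF (x := box_rg F) (y := y); try lra.
  exists (lift ord_max i); rewrite !extend_lift; split=> //.
  have [_ ? ?] := tile_x tF i.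
  by have [[-> [? ?]]|[-> ?]] := rgP i; lra.
- apply: ord_max_ind => [i|]; apply: ord_max_ind => [j|] /=;
    rewrite ?extend_lift ?extend_max.
  + by move=> /andP[h1 h2]; apply: (cross_lf tF); rewrite h1 xm.
  + by have [? ? ?] := tile_x tF i; lra.
  + by have [? ? ?] := tile_x tF j; have [[-> [? ?]]|[-> ?]] := rgP j; lra.
  by lra.
- apply: ord_max_ind => [i|]; apply: ord_max_ind => [j|] /=;
    rewrite ?extend_lift ?extend_max.
  + have := cross_rg tF (i := i) (j := j); have [? ? ?] := tile_x tF i; have [? ? ?] := tile_x tF j.
    by have [[-> [? ?]]|[-> ?]] := rgP i; have [[-> [? ?]]|[-> ?]] := rgP j; lra.
  + by have [? ? ?] := tile_x tF i; have [[-> [? ?]]|[-> ?]] := rgP i; lra.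
  + by have [? ? ?] := tile_x tF j; have [[-> [? ?]]|[-> ?]] := rgP j; lra.
  by lra.
apply: ord_max_ind => [i|]; apply: ord_max_ind => [j|] //=; rewrite ?extend_lift ?extend_max //.
have := no_corner tF (i := i) (j := j); have [? ? ?] := tile_x tF j.
by have [[-> [? ?]]|[-> ?]] := rgP i; lra.
Qed.

Lemma add_column_canonical : canonical add_column.
Proof.
apply: ord_max_ind => [i|]; apply: ord_max_ind => [j|] ij; rewrite /before /=
  ?extend_lift ?extend_max.
- by apply: cF; move: ij; rewrite !lift_max.
- by have [_ h h'] := tile_x tF i; rewrite (lt_le_trans h h').
- by move: ij; rewrite lift_max /= => /ltn_trans /(_ (ltn_ord j)); rewrite ltnn.
by move: ij; rewrite ltnn.
Qed.

Lemma add_column_code j : code add_column (lift ord_max j) = code F j.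
Proof.
rewrite /code card_ord_recr /counted /= !extend_lift !extend_max.
have [_ xj jb] := tile_x tF j.
rewrite (_ : (_ || _) = false) ?addn0; last by lra.
apply: eq_card => i; rewrite !inE !extend_lift.
by have [[-> [-> _]]|[-> _]] := rgP i => //; lra.
Qed.

Lemma add_column_code_max :
  code add_column ord_max = (n.+1 - #|[set i | (rg F i == box_rg F) && (lo F i < lo F u)%R]|)%N.
Proof.
have [_ yu ub'] := tile_y tF u.
rewrite /code card_ord_recr /counted /= !extend_max (_ : (_ || _) = false) ?addn0; last by lra.
rewrite -card_setC_ord; apply: eq_card => i; rewrite !inE extend_lift extend_lift -/(kept i).
have [_ _ ib] := tile_x tF i; have [_ yi ib'] := tile_y tF i.
by have [/keptP[_ -> _]|/not_kept[-> _]] := boolP (kept i); lra.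
Qed.

(** Tracks the maximum: the tiles not reaching the new right side are exactly those counted by the
    new code. *)
Lemma add_column_done : #|[set i | rg add_column i < box_rg add_column]| =
  (n.+1 - #|[set i | (rg F i == box_rg F) && (lo F i < lo F u)%R]|)%N.
Proof.
rewrite card_ord_recr /= !extend_max ltxx addn0.
rewrite -card_setC_ord; apply: eq_card => i; rewrite !inE extend_lift -/(kept i).
have [_ _ ib] := tile_x tF i.
by have [/keptP[_ -> _]|/not_kept[-> _]] := boolP (kept i); lra.
Qed.

(** Tracks the bound [b], which is one more than the old maximum. *)
Lemma add_column_before_last : #|[set i | rg add_column i < lf add_column ord_max]| =
  #|[set i | rg F i < box_rg F]|.
Proof.
rewrite card_ord_recr /= !extend_max (_ : (_ < _) = false) ?addn0; last by lra.
apply: eq_card => i; rewrite !inE extend_lift.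
by have [[-> [-> _]]|[-> _]] := rgP i; lra.
Qed.

End AddColumn.

Section SplitLast.
Variables (F : @frame R 'I_n.+1) (y : R).
Hypotheses (tF : top_tiling F) (cF : canonical F).
Hypothesis yl : lo F ord_max < y < hi F ord_max.
Hypothesis yN : forall i, rg F i = lf F ord_max -> hi F i != y.

Let lo' i := if i == ord_max then y else lo F i.

(** The upper part of the cut tile keeps its label and the lower part becomes the last tile. By [yN]
    the cut misses the tops at its left, so [no_corner] survives. *)
Definition split_last := Frame
  (extend (lf F) (lf F ord_max)) (extend (rg F) (box_rg F))
  (extend lo' (lo F ord_max)) (extend (hi F) y)
  (box_lf F) (box_rg F) (box_lo F) (box_hi F).

Let loP i : (i = ord_max /\ lo' i = y) \/ (i != ord_max /\ lo' i = lo F i).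
Proof. by rewrite /lo'; case: eqP; [left|right]. Qed.

Let lo_ge i : lo F i <= lo' i.
Proof. have yl' := yl; by have [[-> ->]|[_ ->]] := loP i; lra. Qed.

Lemma split_last_tiling : top_tiling split_last.
Proof.
have lX := rg_max tF cF; have yl'' := yl.
have [bl xl lb] := tile_x tF ord_max; have [bl' yl' lb'] := tile_y tF ord_max.
have maxE i : xmeet F i ord_max -> ymeet F i ord_max -> i = ord_max by apply: (tile_disj tF).
split; [split| | |].
- apply: ord_max_ind => [j|] /=; rewrite ?extend_lift ?extend_max; last by split; lra.
  exact: (tile_x tF).
- apply: ord_max_ind => [j|] /=; rewrite ?extend_lift ?extend_max; last by split; lra.
  by have [? ? ?] := tile_y tF j; have [[-> ->]|[_ ->]] := loP j; split; lra.
- apply: ord_max_ind => [i|]; apply: ord_max_ind => [j|] //;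
    rewrite /xmeet /ymeet /= ?extend_lift ?extend_max.
  + move=> xij /andP[yij yji]; congr lift; apply: (tile_disj tF) => //.
    by rewrite /ymeet !(le_lt_trans (lo_ge _)).
  + move=> xij /andP[yij yji]; exfalso; have [[_ e]|[/eqP ne e]] := loP i; first lra.
    by case: ne; apply: maxE; rewrite /xmeet /ymeet; lra.
  move=> xij /andP[yij yji]; exfalso; have [[_ e]|[/eqP ne e]] := loP j; first lra.
  by case: ne; apply: maxE; rewrite /xmeet /ymeet; lra.
- move=> x z /= xb zb; have [i [xi zi]] := tile_cov tF xb zb.
  have [[im e]|[ne e]] := loP i; last by exists (lift ord_max i); rewrite !extend_lift e.
  rewrite im in xi zi; have [zy|yz] := leP z y; first by exists ord_max; rewrite !extend_max; lra.
  by exists (lift ord_max i); rewrite !extend_lift e im; lra.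
- apply: ord_max_ind => [i|]; apply: ord_max_ind => [j|] /=;
    rewrite ?extend_lift ?extend_max.
  + by move=> /(cross_lf tF) h; apply: le_trans h (lo_ge i).
  + by have := last_column i cF; lra.
  + exact: (cross_lf tF).
  by lra.
- apply: ord_max_ind => [i|]; apply: ord_max_ind => [j|] /=;
    rewrite ?extend_lift ?extend_max.
  + by move=> /(cross_rg tF) h; apply: le_trans h (lo_ge i).
  + by have [|] := rg_last i tF cF; lra.
  + by have [_ _ ?] := tile_x tF j; lra.
  by lra.
apply: ord_max_ind => [i|]; apply: ord_max_ind => [j|] //=; rewrite ?extend_lift ?extend_max.
- exact: (no_corner tF).
- by move=> /yN /eqP.
- by have [? ? ?] := tile_x tF j; lra.
by lra.
Qed.

Lemma split_last_canonical : canonical split_last.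
Proof.
apply: ord_max_ind => [i|]; apply: ord_max_ind => [j|] ij; rewrite /before /=
  ?extend_lift ?extend_max.
- by apply: cF; move: ij; rewrite !lift_max.
- have yl' := yl; have [->|ne] := eqVneq i ord_max; first by rewrite ltxx eqxx /=; lra.
  have im : (i < @ord_max n)%N by rewrite ltn_neqAle (inj_eq val_inj) ne -ltnS /=.
  by have /orP[->//|/andP[-> h]] := cF im; rewrite (lt_trans _ h) ?orbT; lra.
- by move: ij; rewrite lift_max /= => /ltn_trans /(_ (ltn_ord j)); rewrite ltnn.
by move: ij; rewrite ltnn.
Qed.

Lemma split_last_code j : code split_last (lift ord_max j) = code F j.
Proof.
rewrite /code card_ord_recr /counted /= !extend_lift !extend_max.
have [_ xj jb] := tile_x tF j.
rewrite (_ : (_ || _) = false) ?addn0; last by lra.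
apply: eq_card => i; rewrite !inE !extend_lift.
have [[-> ->]|[_ ->//]] := loP i.
by rewrite rg_max //; lra.
Qed.

Lemma split_last_code_max : code split_last ord_max =
  (#|[set i | (rg F i < lf F ord_max)%R]| +
   #|[set i | (rg F i == lf F ord_max) && (lo F i < y)%R]|)%N.
Proof.
have [_ xl lb] := tile_x tF ord_max.
rewrite /code card_ord_recr /counted /= !extend_max (_ : (_ || _) = false) ?addn0; last by lra.
rewrite -cardsUI [X in (_ + X)%N](_ : _ = 0%N) ?addn0.
  apply: eq_card => i; rewrite !inE !extend_lift.
  by have [[-> ->]|[_ ->//]] := loP i; rewrite rg_max //; lra.
by apply/eqP; rewrite cards_eq0; apply/eqP/setP => i; rewrite !inE; lra.
Qed.

Lemma split_last_done : #|[set i | rg split_last i < box_rg split_last]| =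
  #|[set i | rg F i < box_rg F]|.
Proof.
rewrite card_ord_recr /= !extend_max ltxx addn0.
by apply: eq_card => i; rewrite !inE extend_lift.
Qed.

Lemma split_last_before_last : #|[set i | rg split_last i < lf split_last ord_max]| =
  #|[set i | rg F i < lf F ord_max]|.
Proof.
have [_ xl lb] := tile_x tF ord_max.
rewrite card_ord_recr /= !extend_max (_ : (_ < _) = false) ?addn0; last by lra.
by apply: eq_card => i; rewrite !inE extend_lift.
Qed.

End SplitLast.
End Construction.

(** * Every admissible sequence is a code *)

Section Realize.
Context {R : realFieldType}.
Local Open Scope ring_scope.
Local Open Scope set_scope.

Lemma lo_inj_rg n (F : @frame R 'I_n) x : tiling F ->
  {in [set i | rg F i == x] &, injective (lo F)}.
Proof.
move=> tF i j; rewrite !inE => /eqP ix /eqP jx e; apply: (tile_disj tF).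
  by have [_ xi _] := tile_x tF i; have [_ xj _] := tile_x tF j; rewrite /xmeet; lra.
by have [_ yi _] := tile_y tF i; have [_ yj _] := tile_y tF j; rewrite /ymeet; lra.
Qed.

(** A left neighbour with a lower bottom would face a tile of the last column below the last tile,
    against the canonical order. *)
Lemma lo_max_le n (F : @frame R 'I_n.+1) i : top_tiling F -> canonical F ->
  rg F i = lf F ord_max -> lo F ord_max <= lo F i.
Proof.
move=> tF cF il; have [bi xi _] := tile_x tF i; have [_ xl lb] := tile_x tF ord_max.
have [bi' yi ib'] := tile_y tF i; have [_ yl _] := tile_y tF ord_max.
rewrite leNgt; apply/negP => lil.
have [||k [xk yk]] := corner_pp tF (x := lf F ord_max) (y := lo F i); try lra.
have kl : lf F k = lf F ord_max.
  apply/eqP; rewrite eq_le; have [-> _] := andP xk; rewrite /= leNgt; apply/negP => ltx.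
  by have := cross_rg tF (i := i) (j := k); lra.
have km : k != ord_max by apply/eqP => e; move: yk; rewrite e; lra.
have kl' : (k < @ord_max n)%N by rewrite ltn_neqAle (inj_eq val_inj) km -ltnS /=.
have [_ yk' _] := tile_y tF k.
have := cF _ _ kl'; rewrite /before kl ltxx eqxx /=.
by case: (disj_y tF km (xmeet_same_lf tF kl)); lra.
Qed.

Lemma cut_point n (F : @frame R 'I_n.+1) v : top_tiling F -> canonical F ->
  box_lf F < lf F ord_max ->
  (#|[set i | (rg F i < lf F ord_max)%R]| < v <= code F ord_max)%N ->
  exists y, [/\ lo F ord_max < y < hi F ord_max,
    forall i, rg F i = lf F ord_max -> hi F i != y &
    (#|[set i | (rg F i < lf F ord_max)%R]| +
     #|[set i | (rg F i == lf F ord_max) && (lo F i < y)%R]|)%N = v].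
Proof.
move=> tF cF bl /andP[Mv vc].
pose m := #|[set i | rg F i < lf F ord_max]|; rewrite -/m in Mv *.
pose E := [set i | rg F i == lf F ord_max].
have codeE : code F ord_max = (m + #|[set i in E | (lo F i < hi F ord_max)%R]|)%N.
  rewrite /code -cardsUI [X in (_ + X)%N](_ : _ = 0%N) ?addn0.
    by apply: eq_card => i; rewrite !inE.
  by apply/eqP; rewrite cards_eq0; apply/eqP/setP => i; rewrite !inE; lra.
(* A cut just above the bottom of [u] also counts [u], hence the predecessor of [v - m]. *)
have [|u uE ucard] := order_statistic (E := E) (f := lo F) (k := (v - m).-1) (lo_inj_rg tF).
  have : (#|[set i in E | (lo F i < hi F ord_max)%R]| <= #|E|)%N.
    by apply: subset_leq_card; apply/fintype.subsetP => i; rewrite !inE => /andP[].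
  by move: codeE vc Mv; lia.
have ux : rg F u = lf F ord_max by apply/eqP; move: uE; rewrite inE.
have ul : lo F u < hi F ord_max.
  rewrite ltNge; apply/negP => lu.
  have : (#|[set i in E | (lo F i < hi F ord_max)%R]| <= #|[set i in E | (lo F i < lo F u)%R]|)%N.
    by apply: subset_leq_card; apply/fintype.subsetP => i; rewrite !inE => /andP[-> /lt_le_trans]; apply.
  by rewrite ucard; move: codeE vc Mv; lia.
have lu := lo_max_le tF cF ux; have [_ yu _] := tile_y tF u; have [_ yl _] := tile_y tF ord_max.
have [y [uy yu' yl']] : exists y, [/\ lo F u < y, y < hi F u & y < hi F ord_max].
  by have [?|?] := leP (hi F u) (hi F ord_max);
    [exists ((lo F u + hi F u) / 2)|exists ((lo F u + hi F ord_max) / 2)]; split; lra.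
have sep i : rg F i = lf F ord_max -> i != u -> hi F i <= lo F u \/ hi F u <= lo F i.
  move=> ix iu; apply: disj_y => //.
  by have [_ xi _] := tile_x tF i; have [_ xu _] := tile_x tF u; rewrite /xmeet; lra.
exists y; split; first lra.
  move=> i ix; have [_ yi _] := tile_y tF i; apply/eqP => iy.
  by have [iu|iu] := eqVneq i u; [move: iy; rewrite iu; lra|case: (sep i ix iu); lra].
have -> : [set i | (rg F i == lf F ord_max) && (lo F i < y)%R] =
    u |: [set i in E | lo F i < lo F u].
  apply/setP => i; rewrite !inE; have [->|iu] /= := eqVneq i u; first by rewrite ux eqxx.
  by have [_ yi _] := tile_y tF i; case: eqP => //= ix; case: (sep i ix iu); lra.
by rewrite cardsU1 ucard !inE ltxx andbF /=; lia.
Qed.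

(** The state of the word is visible in the tiling: [M] counts the tiles that no longer reach the
    right side, [b] is one more than the number of tiles closed strictly before the last column (0
    in the first column), and [w] is the last code. The entries allowed by [state1P] are then the
    ones that a cut or a new column can produce. *)
Lemma realize n s M b w : size s = n.+1 -> valid bad1 s -> state1 s = (M, b, w) ->
  exists F : @frame R 'I_n.+1,
    [/\ top_tiling F, canonical F, forall j, code F j = nth 0%N s (n - j),
        M = #|[set i | rg F i < box_rg F]| &
        b = if lf F ord_max == box_lf F then 0%N else #|[set i | rg F i < lf F ord_max]|.+1].
Proof.
elim: n s M b w => [|n IH] [//|v s] M b w [sz] /= /and3P[vs vsz fv].
  case: s sz vs vsz fv => // _ _; rewrite leqn0 => /eqP -> _ /= [<- <- _].
  exists (Frame (fun=> 0) (fun=> 1) (fun=> 0) (fun=> 1) 0 1 0 1).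
  have no_counted i j : counted (Frame (I := 'I_1) (fun=> 0) (fun=> 1) (fun=> 0) (fun=> 1) 0 1 0 1 : @frame R 'I_1) i j = false.
    by rewrite /counted /=; lra.
  split=> /=.
  - split; [split=> /= [i|i|i j _ _|x y xb yb]|..] => //=; try by split; lra.
    + by rewrite !ord1.
    + by exists ord0.
    + by move=> i j; lra.
    + by move=> i j; lra.
  - by move=> i j; rewrite !ord1.
  - by move=> j; rewrite !ord1 /=; apply/eqP; rewrite cards_eq0; apply/eqP/setP => i; rewrite !inE no_counted.
  - by apply/esym/eqP; rewrite cards_eq0; apply/eqP/setP => i; rewrite !inE ltxx.
  by rewrite eqxx.
case E : (state1 s) => [[M' b'] w'].
have [F [tF cF cE ME bE]] := IH _ _ _ _ sz vs E.
have [bw Ms _ _ frE] := state1P vs E.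
have wE : w' = code F ord_max.
  by rewrite cE subnn; move: E sz; case: (s) => //= u t; case: (state1 t) => [[? ?] ?];
    case: ifP => _ [_ _ <-].
have codeS (G : @frame R 'I_n.+2) : (forall j, code G (lift ord_max j) = code F j) ->
    code G ord_max = v -> forall j, code G j = nth 0%N (v :: s) (n.+1 - j).
  move=> h h'; apply: ord_max_ind => [j|]; last by rewrite h' subnn.
  by rewrite h cE lift_max subSn // -ltnS.
move: fv; rewrite frE => /orP[vbw|Mv]; last first.
  rewrite Mv => -[<- <- _].
  have Fcard : (#|[set i | rg F i == box_rg F]| = n.+1 - M')%N.
    rewrite ME -card_setC_ord; apply: eq_card => i; rewrite !inE.
    by have [_ _ ib] := tile_x tF i; lra.
  (* With [n.+1 - v] open tiles below [u] prolonged, the remaining [v] tiles are counted by the new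
     one. *)
  have [|u] := order_statistic (E := [set i | rg F i == box_rg F]) (f := lo F)
    (k := (n.+1 - v)%N) (lo_inj_rg tF); first by rewrite Fcard; lia.
  rewrite inE => /eqP uX ucard.
  have {ucard} vE : (n.+1 - #|[set i | (rg F i == box_rg F) && (lo F i < lo F u)%R]|)%N = v.
    rewrite (_ : [set i | _] = [set i in [set i | rg F i == box_rg F] | lo F i < lo F u]).
      by rewrite ucard; lia.
    by apply/setP => i; rewrite !inE.
  exists (add_column F u); split.
  - exact: add_column_tiling.
  - exact: add_column_canonical.
  - apply: codeS => [j|]; first exact: add_column_code.
    by rewrite add_column_code_max.
  - by rewrite add_column_done.
  rewrite add_column_before_last // -ME /= extend_max; case: eqP => // e.
  by have [h1 h2 h3] := tile_x tF ord_max; have := le_lt_trans h1 (lt_le_trans h2 h3); rewrite e ltxx.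
have -> : (M' < v)%N = false by lia.
move=> [<- <- _].
have [y [yl yN vE]] : exists y, [/\ lo F ord_max < y < hi F ord_max,
    forall i, rg F i = lf F ord_max -> hi F i != y &
    (#|[set i | (rg F i < lf F ord_max)%R]| +
     #|[set i | (rg F i == lf F ord_max) && (lo F i < y)%R]|)%N = v].
  have [bl xl _] := tile_x tF ord_max; have [_ yl _] := tile_y tF ord_max.
  move: bE; case: eqP => [lE|/eqP lN] bE; last first.
    apply: cut_point => //; first by rewrite lt_neqAle eq_sym lN.
    by rewrite -wE -bE.
  (* In the first column nothing lies to the left, so the entry is 0 and any height of the cut will
     do. *)
  have noleft i : (rg F i <= lf F ord_max) = false.
    by have [? ? _] := tile_x tF i; lra.
  exists ((lo F ord_max + hi F ord_max) / 2); split; first lra.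
    by move=> i e; have := noleft i; rewrite e lexx.
  have w0 : w' = 0%N.
    rewrite wE; apply/eqP; rewrite cards_eq0; apply/eqP/setP => i; rewrite !inE.
    by have := noleft i; rewrite /counted; lra.
  have -> : v = 0%N by lia.
  by apply/eqP; rewrite addn_eq0 !cards_eq0; apply/andP; split; apply/eqP/setP => i;
    rewrite !inE; have := noleft i; lra.
exists (split_last F y); split.
- exact: split_last_tiling.
- exact: split_last_canonical.
- apply: codeS => [j|]; first exact: split_last_code.
  by rewrite split_last_code_max.
- by rewrite split_last_done.
by rewrite split_last_before_last // bE /= extend_max.
Qed.

End Realize.

(** * Geometry *)

Section Geometry.
Context {R : realType} {n : nat}.
Import numFieldNormedType.Exports.
Local Open Scope classical_set_scope.
Local Open Scope ring_scope.
Implicit Types (d : decomposition R n) (r : rectangulation R n) (i j : 'I_n) (x y : R).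

Definition frame_of d : @frame R 'I_n :=
  Frame (fun i => xmin (tile d i)) (fun i => xmax (tile d i))
    (fun i => ymin (tile d i)) (fun i => ymax (tile d i))
    (xmin (box d)) (xmax (box d)) (ymin (box d)) (ymax (box d)).

Lemma regionE (q : rect R) x y :
  region q (x, y) <-> xmin q <= x <= xmax q /\ ymin q <= y <= ymax q.
Proof. by rewrite /region /= !in_itv. Qed.

Lemma vsegE x y0 y1 (p : R * R) : vseg x y0 y1 p <-> p.1 = x /\ y0 <= p.2 <= y1.
Proof. by rewrite /vseg /= in_itv. Qed.

Lemma hsegE y x0 x1 (p : R * R) : hseg y x0 x1 p <-> p.2 = y /\ x0 <= p.1 <= x1.
Proof. by rewrite /hseg /= in_itv; split=> -[]. Qed.

Lemma vseg_sub x a b x' c e : a <= b ->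
  (vseg x a b `<=` vseg x' c e) <-> [/\ x = x', c <= a & b <= e].
Proof.
move=> ab; split=> [h|[-> ca bd] [p q] /vsegE[/= -> pq]]; last by apply/vsegE; split=> //=; lra.
have /vsegE[/= -> ?] : vseg x' c e (x, a) by apply: h; apply/vsegE; rewrite /= lexx ab.
have /vsegE[/= _ ?] : vseg x' c e (x, b) by apply: h; apply/vsegE; rewrite /= lexx ab.
by split=> //; lra.
Qed.

Lemma hseg_sub y a b y' c e : a <= b ->
  (hseg y a b `<=` hseg y' c e) <-> [/\ y = y', c <= a & b <= e].
Proof.
move=> ab; split=> [h|[-> ca bd] [p q] /hsegE[/= -> pq]]; last by apply/hsegE; split=> //=; lra.
have /hsegE[/= -> ?] : hseg y' c e (a, y) by apply: h; apply/hsegE; rewrite /= lexx ab.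
have /hsegE[/= _ ?] : hseg y' c e (b, y) by apply: h; apply/hsegE; rewrite /= lexx ab.
by split=> //; lra.
Qed.

Lemma hseg_nsub_vseg y a b x c e : a < b -> ~ (hseg y a b `<=` vseg x c e).
Proof.
move=> ab h.
have /vsegE[/= ax _] : vseg x c e (a, y) by apply: h; apply/hsegE; rewrite /= lexx ltW.
have /vsegE[/= bx _] : vseg x c e (b, y) by apply: h; apply/hsegE; rewrite /= lexx ltW.
lra.
Qed.

Lemma vseg_nsub_hseg x a b y c e : a < b -> ~ (vseg x a b `<=` hseg y c e).
Proof.
move=> ab h.
have /hsegE[/= ax _] : hseg y c e (x, a) by apply: h; apply/vsegE; rewrite /= lexx ltW.
have /hsegE[/= bx _] : hseg y c e (x, b) by apply: h; apply/vsegE; rewrite /= lexx ltW.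
lra.
Qed.

Lemma interior_region (q : rect R) :
  (region q)° = [set` `]xmin q, xmax q[] `*` [set` `]ymin q, ymax q[].
Proof.
have openE a b : [set` `]a, b[] = [set` `[a, b]]° :> set R by rewrite interior_itv_bnd.
rewrite !openE; apply/seteqP; split=> [[x y]|[x y] [xq yq]].
  case=> -[A B] /= [xA yB] AB; split=> /=.
    by apply: filterS xA => u Au; have [] := AB (u, y) (conj Au (nbhs_singleton yB)).
  by apply: filterS yB => v Bv; have [] := AB (x, v) (conj (nbhs_singleton xA) Bv).
by exists ([set` `[xmin q, xmax q]], [set` `[ymin q, ymax q]]).
Qed.

Lemma tiling_frame_of d : tiling (frame_of d).
Proof.
have inbox i x y : xmin (tile d i) <= x <= xmax (tile d i) ->
    ymin (tile d i) <= y <= ymax (tile d i) ->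
    xmin (box d) <= x <= xmax (box d) /\ ymin (box d) <= y <= ymax (box d).
  move=> xi yi; suff /regionE : region (box d) (x, y) by [].
  by rewrite -(tile_cover d); exists i => //; apply/regionE.
have xlt i := xmin_lt_xmax (tile d i); have ylt i := ymin_lt_ymax (tile d i).
have corner0 i : xmin (box d) <= xmin (tile d i) <= xmax (box d) /\
    ymin (box d) <= ymin (tile d i) <= ymax (box d).
  by apply: (inbox i); rewrite lexx ltW.
have corner1 i : xmin (box d) <= xmax (tile d i) <= xmax (box d) /\
    ymin (box d) <= ymax (tile d i) <= ymax (box d).
  by apply: (inbox i); rewrite lexx ltW.
split=> /= [i|i|i j|x y xb yb].
- by have := corner0 i; have := corner1 i; have := xlt i; split; lra.
- by have := corner0 i; have := corner1 i; have := ylt i; split; lra.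
- rewrite /xmeet /ymeet /= => xij yij; apply/eqP; apply: contraT => /(@tile_disjoint _ _ d).
  rewrite !interior_region => /seteqP[/(_ (_, _)) h _].
  have mid (a b c e : R) : a < b -> c < e -> a < e -> c < b -> exists z, a < z < b /\ c < z < e.
    move=> ab ce ae cb; have [?|?] := leP a c; have [?|?] := leP b e;
      by [exists ((c + b) / 2); lra|exists ((c + e) / 2); lra|exists ((a + b) / 2); lra|exists ((a + e) / 2); lra].
  have [||u [u1 u2]] := mid _ _ _ _ (xlt i) (xlt j); try lra.
  have [||v [v1 v2]] := mid _ _ _ _ (ylt i) (ylt j); try lra.
  by case: (h u v); rewrite /= !in_itv /= u1 u2 v1 v2.
have : region (box d) (x, y) by apply/regionE.
by rewrite -(tile_cover d) => -[i _ /regionE]; exists i.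
Qed.

Lemma union_vsegE d x y0 y1 :
  union_of_sides d (vseg x y0 y1) <-> side_union (frame_of d) x y0 y1.
Proof.
split=> [[S Ssides vE] y yy|u].
  have : vseg x y0 y1 (x, y) by apply/vsegE.
  have sub s : S s -> s `<=` vseg x y0 y1 by move=> Ss p sp; rewrite vE; exists s.
  rewrite {1}vE => -[s Ss sxy]; have [i _ si] := Ssides _ Ss.
  have yi := ltW (ymin_lt_ymax (tile d i)); have xi := xmin_lt_xmax (tile d i).
  exists i; rewrite /on_line /=; case: si (sub _ Ss) sxy => ->.
  - by move=> /(vseg_sub _ _ _ _ yi)[-> ? ?] /vsegE[_ /= ?]; rewrite eqxx.
  - by move=> /(vseg_sub _ _ _ _ yi)[-> ? ?] /vsegE[_ /= ?]; rewrite eqxx orbT.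
  - by move=> /(hseg_nsub_vseg xi).
  by move=> /(hseg_nsub_vseg xi).
exists [set s | (\bigcup_i sides (tile d i)) s /\ s `<=` vseg x y0 y1]; first by move=> s [].
apply/seteqP; split=> [[a b] /vsegE[/= -> yb]|p [s [_ +] sp]]; last exact.
have [i [xi bi ? ?]] := u b yb.
have yi := ltW (ymin_lt_ymax (tile d i)).
case/orP: xi => /eqP /= xi; [exists (left_side (tile d i))|exists (right_side (tile d i))].
- by split; [exists i => //; constructor 1|apply/vseg_sub].
- by apply/vsegE; rewrite /= xi.
- by split; [exists i => //; constructor 2|apply/vseg_sub].
by apply/vsegE; rewrite /= xi.
Qed.

Lemma union_hsegE d y x0 x1 :
  union_of_sides d (hseg y x0 x1) <-> side_union (transpose (frame_of d)) y x0 x1.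
Proof.
split=> [[S Ssides vE] x xx|u].
  have : hseg y x0 x1 (x, y) by apply/hsegE.
  have sub s : S s -> s `<=` hseg y x0 x1 by move=> Ss p sp; rewrite vE; exists s.
  rewrite {1}vE => -[s Ss sxy]; have [i _ si] := Ssides _ Ss.
  have yi := ymin_lt_ymax (tile d i); have xi := ltW (xmin_lt_xmax (tile d i)).
  exists i; rewrite /on_line /=; case: si (sub _ Ss) sxy => ->.
  - by move=> /(vseg_nsub_hseg yi).
  - by move=> /(vseg_nsub_hseg yi).
  - by move=> /(hseg_sub _ _ _ _ xi)[-> ? ?] /hsegE[_ /= ?]; rewrite eqxx.
  by move=> /(hseg_sub _ _ _ _ xi)[-> ? ?] /hsegE[_ /= ?]; rewrite eqxx orbT.
exists [set s | (\bigcup_i sides (tile d i)) s /\ s `<=` hseg y x0 x1]; first by move=> s [].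
apply/seteqP; split=> [[a b] /hsegE[/= -> xb]|p [s [_ +] sp]]; last exact.
have [i [yi bi ? ?]] := u a xb.
have xi := ltW (xmin_lt_xmax (tile d i)).
case/orP: yi => /eqP /= yi; [exists (bottom_side (tile d i))|exists (top_side (tile d i))].
- by split; [exists i => //; constructor 3|apply/hseg_sub].
- by apply/hsegE; rewrite /= yi.
- by split; [exists i => //; constructor 4|apply/hseg_sub].
by apply/hsegE; rewrite /= yi.
Qed.

Lemma perimeterP (q : rect R) x y : perimeter q (x, y) <->
  [/\ xmin q <= x <= xmax q, ymin q <= y <= ymax q &
      [\/ x = xmin q, x = xmax q, y = ymin q | y = ymax q]].
Proof.
have xq := xmin_lt_xmax q; have yq := ymin_lt_ymax q.
split=> [[S [] ->]|[xx yy [] e]].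
- by case/vsegE=> /= -> ?; split; [lra|lra|constructor 1].
- by case/vsegE=> /= -> ?; split; [lra|lra|constructor 2].
- by case/hsegE=> /= -> ?; split; [lra|lra|constructor 3].
- by case/hsegE=> /= -> ?; split; [lra|lra|constructor 4].
- by exists (left_side q); [constructor 1|apply/vsegE].
- by exists (right_side q); [constructor 2|apply/vsegE].
- by exists (bottom_side q); [constructor 3|apply/hsegE].
by exists (top_side q); [constructor 4|apply/hsegE].
Qed.

Lemma vertical_segmentE d x y0 y1 :
  vertical_segment d x y0 y1 <-> max_segment (frame_of d) x y0 y1.
Proof.
have tF := tiling_frame_of d.
split=> [[y01 /union_vsegE u mx np]|[y01 xb u mx]].
  have [/= by0 by1] := side_union_box tF (ltW y01) u.
  have [|i [xi _ _ _]] := u y0; first by rewrite lexx ltW.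
  have [/= bi xi' ib] := tile_x tF i.
  split=> //= [|z0 z1 v zy yz].
    rewrite !lt_neqAle; apply/andP; split; apply/andP; split.
    - apply/eqP => xE; apply: np => -[a b] /vsegE[/= -> yb]; apply/perimeterP.
      by split; [lra|lra|constructor 1].
    - by case/orP: xi => /eqP /= <-; lra.
    - apply/eqP => xE; apply: np => -[a b] /vsegE[/= -> yb]; apply/perimeterP.
      by split; [lra|lra|constructor 2].
    by case/orP: xi => /eqP /= <-; lra.
  have zE : vseg x z0 z1 = vseg x y0 y1.
    by apply: mx; [apply/union_vsegE|apply/vseg_sub; [exact: ltW|split]].
  have : vseg x z0 z1 `<=` vseg x y0 y1 by rewrite zE.
  by move=> /vseg_sub[|_ ? ?]; [|split]; lra.
have [/= by0 by1] := side_union_box tF (ltW y01) u.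
split=> //; first exact/union_vsegE.
  by move=> z0 z1 /union_vsegE v /(vseg_sub _ _ _ _ (ltW y01))[_ zy yz]; have [-> ->] := mx _ _ v zy yz.
(* The midpoint is off the horizontal sides of the box and, by [xb], off the vertical ones. *)
move/(_ (x, (y0 + y1) / 2)) => h.
have /h/perimeterP[_ _] : vseg x y0 y1 (x, (y0 + y1) / 2) by apply/vsegE; split=> //=; lra.
by case; rewrite /= in xb; lra.
Qed.

Lemma horizontal_segmentE d y x0 x1 :
  horizontal_segment d y x0 x1 <-> max_segment (transpose (frame_of d)) y x0 x1.
Proof.
have tF := tiling_transpose (tiling_frame_of d).
split=> [[x01 /union_hsegE u mx np]|[x01 yb u mx]].
  have [/= bx0 bx1] := side_union_box tF (ltW x01) u.
  have [|i [yi _ _ _]] := u x0; first by rewrite lexx ltW.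
  have [/= bi yi' ib] := tile_x tF i.
  split=> //= [|z0 z1 v zx xz].
    rewrite !lt_neqAle; apply/andP; split; apply/andP; split.
    - apply/eqP => yE; apply: np => -[a b] /hsegE[/= -> xb]; apply/perimeterP.
      by split; [lra|lra|constructor 3].
    - by case/orP: yi => /eqP /= <-; lra.
    - apply/eqP => yE; apply: np => -[a b] /hsegE[/= -> xb]; apply/perimeterP.
      by split; [lra|lra|constructor 4].
    by case/orP: yi => /eqP /= <-; lra.
  have zE : hseg y z0 z1 = hseg y x0 x1.
    by apply: mx; [apply/union_hsegE|apply/hseg_sub; [exact: ltW|split]].
  have : hseg y z0 z1 `<=` hseg y x0 x1 by rewrite zE.
  by move=> /hseg_sub[|_ ? ?]; [|split]; lra.
have [/= bx0 bx1] := side_union_box tF (ltW x01) u.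
split=> //; first exact/union_hsegE.
  by move=> z0 z1 /union_hsegE v /(hseg_sub _ _ _ _ (ltW x01))[_ zx xz]; have [-> ->] := mx _ _ v zx xz.
move/(_ ((x0 + x1) / 2, y)) => h.
have /h/perimeterP[_ _] : hseg y x0 x1 ((x0 + x1) / 2, y) by apply/hsegE; split=> //=; lra.
by case; rewrite /= in yb; lra.
Qed.

Lemma clos_trans_iff (T : Type) (e e' : T -> T -> Prop) : (forall a b, e a b <-> e' a b) ->
  forall a b, clos_trans T e a b <-> clos_trans T e' a b.
Proof.
move=> ee a b; split; elim=> [{}a {}b /ee|{}a c {}b _ h _]; by [apply: t_step|apply: t_trans].
Qed.

Lemma right_stepE d i j : right_step d i j <-> step (frame_of d) i j.
Proof.
have yi := ltW (ymin_lt_ymax (tile d i)); have yj := ltW (ymin_lt_ymax (tile d j)).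
split=> -[x [y0 [y1 H]]]; exists x, y0, y1.
  by case: H => [/vertical_segmentE m /(vseg_sub _ _ _ _ yi)[? ? ?] /(vseg_sub _ _ _ _ yj)[? ? ?]].
by case: H => [/vertical_segmentE m [? ?] ? [? ?] ?]; split=> //; apply/vseg_sub.
Qed.

Lemma above_stepE d i j : above_step d i j <-> step (transpose (frame_of d)) i j.
Proof.
have xi := ltW (xmin_lt_xmax (tile d i)); have xj := ltW (xmin_lt_xmax (tile d j)).
split=> -[y [x0 [x1 H]]]; exists y, x0, x1.
  by case: H => [/horizontal_segmentE m /(hseg_sub _ _ _ _ xi)[? ? ?] /(hseg_sub _ _ _ _ xj)[? ? ?]].
by case: H => [/horizontal_segmentE m [? ?] ? [? ?] ?]; split=> //; apply/hseg_sub.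
Qed.

Lemma top_tiling_frame_of r : vertical_segments_reach_top r <-> top_tiling (frame_of r).
Proof.
have tF := tiling_frame_of r; split=> [top|tt x y0 y1 /vertical_segmentE m].
  apply: top_tiling_of_generic => // [x y0 y1 y x0 x1 /vertical_segmentE v /horizontal_segmentE h|].
    exact: decomp_generic v h.
  by move=> x y0 y1 /vertical_segmentE /top /hsegE[].
have [_ /= xb _ _] := m; apply/hsegE; split=> /=; last lra.
exact: (top_tiling_reaches_top tt m).
Qed.

Lemma right_ofE r i j : top_tiling (frame_of r) ->
  right_of r i j <-> right_rel (frame_of r) i j.
Proof. by move=> tF; rewrite -right_relE //; apply: clos_trans_iff => a b; exact: right_stepE. Qed.

Lemma aboveE r i j : top_tiling (frame_of r) -> above r i j <-> above_rel (frame_of r) i j.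
Proof. by move=> tF; rewrite -above_relE //; apply: clos_trans_iff => a b; exact: above_stepE. Qed.

(** [contact] is reflexive and [touch] is not, hence the separate case. For distinct tiles, a common
    segment makes the ranges overlap in its own direction; disjoint interiors then leave only a
    common line in the other. *)
Lemma contactE d i j : contact (tile d i) (tile d j) <-> i = j \/ touch (frame_of d) i j.
Proof.
have tF := tiling_frame_of d.
have [/= _ xi _] := tile_x tF i; have [/= _ xj _] := tile_x tF j.
have [/= _ yi _] := tile_y tF i; have [/= _ yj _] := tile_y tF j.
split=> [[a [b [c [bc [h|h]]]]]|].
- have /h[/perimeterP[? ? _] /perimeterP[? ? _]] : vseg a b c (a, b).
    by apply/vsegE; rewrite /= lexx ltW.
  have /h[/perimeterP[? ? _] /perimeterP[? ? _]] : vseg a b c (a, c).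
    by apply/vsegE; rewrite /= lexx ltW.
  have yij : ymeet (frame_of d) i j by rewrite /ymeet /=; lra.
  have [ij|nij] := eqVneq i j; [by left|right].
  have nx : ~~ xmeet (frame_of d) i j by apply: contraNN nij => xij; rewrite (tile_disj tF xij yij).
  by move: nx yij; rewrite /touch /vtouch /htouch /ymeet /xmeet /=; lra.
- have /h[/perimeterP[? ? _] /perimeterP[? ? _]] : hseg a b c (b, a).
    by apply/hsegE; rewrite /= lexx ltW.
  have /h[/perimeterP[? ? _] /perimeterP[? ? _]] : hseg a b c (c, a).
    by apply/hsegE; rewrite /= lexx ltW.
  have xij : xmeet (frame_of d) i j by rewrite /xmeet /=; lra.
  have [ij|nij] := eqVneq i j; [by left|right].
  have ny : ~~ ymeet (frame_of d) i j by apply: contraNN nij => yij; rewrite (tile_disj tF xij yij).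
  by move: ny xij; rewrite /touch /vtouch /htouch /ymeet /xmeet /=; lra.
have common (a b c e : R) : a < b -> c < e -> a < e -> c < b ->
    exists u v, [/\ u < v, a <= u, c <= u, v <= b & v <= e].
  move=> ab ce ae cb; have [?|?] := leP a c; have [?|?] := leP b e;
    by [exists c, b; split; lra|exists c, e; split; lra|exists a, b; split; lra|exists a, e; split; lra].
have vcontact k l : vtouch (frame_of d) k l ->
    contact (tile d k) (tile d l) /\ contact (tile d l) (tile d k).
  have yk := ymin_lt_ymax (tile d k); have yl := ymin_lt_ymax (tile d l).
  have xk := xmin_lt_xmax (tile d k); have xl := xmin_lt_xmax (tile d l).
  case/andP=> /eqP /= kl /andP[/= y1 y2]; have [b [c [bc bk bl ck cl]]] := common _ _ _ _ yk yl y1 y2.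
  have pk : vseg (xmax (tile d k)) b c `<=` perimeter (tile d k).
    by move=> [u v] /vsegE[/= -> ?]; apply/perimeterP; split; [lra|lra|constructor 2].
  have pl : vseg (xmax (tile d k)) b c `<=` perimeter (tile d l).
    by move=> [u v] /vsegE[/= -> ?]; apply/perimeterP; split; [lra|lra|constructor 1].
  by split; exists (xmax (tile d k)), b, c; split=> //; left=> p hp; split;
    [apply: pk|apply: pl|apply: pl|apply: pk].
have hcontact k l : htouch (frame_of d) k l ->
    contact (tile d k) (tile d l) /\ contact (tile d l) (tile d k).
  have yk := ymin_lt_ymax (tile d k); have yl := ymin_lt_ymax (tile d l).
  have xk := xmin_lt_xmax (tile d k); have xl := xmin_lt_xmax (tile d l).
  case/andP=> /eqP /= kl /andP[/= x1 x2]; have [b [c [bc bk bl ck cl]]] := common _ _ _ _ xk xl x1 x2.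
  have pk : hseg (ymax (tile d k)) b c `<=` perimeter (tile d k).
    by move=> [u v] /hsegE[/= -> ?]; apply/perimeterP; split; [lra|lra|constructor 4].
  have pl : hseg (ymax (tile d k)) b c `<=` perimeter (tile d l).
    by move=> [u v] /hsegE[/= -> ?]; apply/perimeterP; split; [lra|lra|constructor 3].
  by split; exists (ymax (tile d k)), b, c; split=> //; right=> p hp; split;
    [apply: pk|apply: pl|apply: pl|apply: pk].
case=> [<-|/or4P[/vcontact[]|/vcontact[]|/hcontact[]|/hcontact[]] //].
exists (xmin (tile d i)), (ymin (tile d i)), (ymax (tile d i)); split=> //; left=> p hp.
by split; exists (left_side (tile d i)); [constructor 1|exact: hp|constructor 1|exact: hp].
Qed.

(** The tile [i0] makes the box nondegenerate. *)
Lemma rectangulation_of (F : @frame R 'I_n) (i0 : 'I_n) : top_tiling F ->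
  exists r, frame_of r = F.
Proof.
move=> tF; have xlt i : lf F i < rg F i by have [] := tile_x tF i.
have ylt i : lo F i < hi F i by have [] := tile_y tF i.
have bx : box_lf F < box_rg F by have [? ? ?] := tile_x tF i0; lra.
have by_ : box_lo F < box_hi F by have [? ? ?] := tile_y tF i0; lra.
pose t i := Rect (xlt i) (ylt i); pose b := Rect bx by_.
have cov : \bigcup_i region (t i) = region b.
  apply/seteqP; split=> [[x y] [i _ /regionE /= [xi yi]]|[x y] /regionE /= [xb yb]].
    have [? ? ?] := tile_x tF i; have [? ? ?] := tile_y tF i.
    by apply/regionE => /=; lra.
  by have [i [? ?]] := tile_cov tF xb yb; exists i => //; apply/regionE.
have dis i j : i != j -> (region (t i))° `&` (region (t j))° = set0.
  move=> /eqP ij; apply/seteqP; split=> // -[x y]; rewrite !interior_region /= !in_itv /=.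
  move=> [[xi yi] [xj yj]]; apply: ij; apply: (tile_disj tF); rewrite /xmeet /ymeet; lra.
pose d := Decomposition cov dis.
have dF : frame_of d = F by rewrite /frame_of /d /t /b /=; case: (F).
have gd : generic d.
  move=> x y0 y1 y x0 x1 /vertical_segmentE v /horizontal_segmentE h.
  by move: v h; rewrite dF; exact: (top_tiling_generic tF).
by exists (Rectangulation gd).
Qed.

End Geometry.

(** * Counting strong classes *)

Section Classes.
Context {R : realType} {n : nat}.
Local Open Scope classical_set_scope.
Implicit Types (r : rectangulation R n) (e : {ffun 'I_n -> 'I_n}).

Definition has_code r e := exists s : 'I_n -> 'I_n,
  [/\ bijective s, canonical (relabel (frame_of r) s) &
      forall j, e j = code (relabel (frame_of r) s) j :> nat].

Lemma strong_equivE r1 r2 : top_tiling (frame_of r1) -> top_tiling (frame_of r2) ->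
  strong_equiv r1 r2 <-> exists phi : 'I_n -> 'I_n, bijective phi /\ forall i j,
    [/\ right_rel (frame_of r1) i j = right_rel (frame_of r2) (phi i) (phi j),
        above_rel (frame_of r1) i j = above_rel (frame_of r2) (phi i) (phi j) &
        touch (frame_of r1) i j = touch (frame_of r2) (phi i) (phi j)].
Proof.
move=> t1 t2.
have irr r i : ~~ touch (frame_of r) i i.
  have [_ xi _] := tile_x (tiling_frame_of r) i; have [_ yi _] := tile_y (tiling_frame_of r) i.
  by rewrite /touch /vtouch /htouch gt_eqF // gt_eqF.
split=> -[phi [bphi h]]; exists phi; split=> // i j; have [h1 h2 h3] := h i j.
  split.
  - by apply/idP/idP=> [/(right_ofE _ _ t1)/h1/(right_ofE _ _ t2)|/(right_ofE _ _ t2)/h1/(right_ofE _ _ t1)].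
  - by apply/idP/idP=> [/(aboveE _ _ t1)/h2/(aboveE _ _ t2)|/(aboveE _ _ t2)/h2/(aboveE _ _ t1)].
  have {}h3 := iff_trans (iff_sym (contactE r1 i j)) (iff_trans h3 (contactE r2 _ _)); have [->|ij] := eqVneq i j.
    by rewrite !(negbTE (irr _ _)).
  have ne : phi i <> phi j by move/(bij_inj bphi)/eqP; rewrite (negbTE ij).
  by move/eqP: ij => ij; apply/idP/idP; tauto.
split.
- by apply: (iff_trans (right_ofE i j t1)); rewrite h1; exact: iff_sym (right_ofE _ _ t2).
- by apply: (iff_trans (aboveE i j t1)); rewrite h2; exact: iff_sym (aboveE _ _ t2).
apply: (iff_trans (contactE r1 i j)); rewrite h3; apply: (iff_trans _ (iff_sym (contactE _ _ _))).
by split=> -[e|->]; [left; rewrite e|right|left; apply: (bij_inj bphi)|right].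
Qed.

Lemma code_exists r : vertical_segments_reach_top r ->
  exists2 e, admissible bad1 e & has_code r e.
Proof.
move/top_tiling_frame_of => tF; have [s bs cs] := exists_canonical tF.
have tG := top_tiling_relabel bs tF.
have bd j : code (relabel (frame_of r) s) j < n by apply: leq_ltn_trans (code_le tG cs j) (ltn_ord j).
exists [ffun j => Ordinal (bd j)]; last by exists s; split=> // j; rewrite ffunE.
by split=> [i|i j k ijk]; rewrite !ffunE /=; [exact: code_le|exact: code_bad1].
Qed.

Lemma code_equiv r1 r2 e : vertical_segments_reach_top r1 -> vertical_segments_reach_top r2 ->
  has_code r1 e -> has_code r2 e -> strong_equiv r1 r2.
Proof.
move=> /top_tiling_frame_of t1 /top_tiling_frame_of t2 [s [bs cs es]] [u [bu cu eu]].
apply/strong_equivE => //; have [s' ss' s's] := bs.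
have ts := top_tiling_relabel bs t1; have tu := top_tiling_relabel bu t2.
have ce : code (relabel (frame_of r1) s) =1 code (relabel (frame_of r2) u).
  by move=> j; rewrite -es -eu.
exists (u \o s'); split; first by apply: bij_comp => //; exists s.
move=> i j; rewrite -{1 3 5}[i]s's -{1 3 5}[j]s's; split.
- exact: (right_rel_code ts cs tu cu ce).
- exact: (above_rel_code ts cs tu cu ce).
exact: (touch_code ts cs tu cu ce).
Qed.

Lemma equiv_code r1 r2 e1 e2 :
  vertical_segments_reach_top r1 -> vertical_segments_reach_top r2 ->
  has_code r1 e1 -> has_code r2 e2 -> strong_equiv r1 r2 -> e1 = e2.
Proof.
move=> /top_tiling_frame_of t1 /top_tiling_frame_of t2 [s [bs cs es]] [u [bu cu eu]].
move/strong_equivE => /(_ t1 t2)[phi [bphi h]]; have [u' uu' u'u] := bu.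
have ts := top_tiling_relabel bs t1; have tu := top_tiling_relabel bu t2.
apply/ffunP => j; apply: val_inj; rewrite /= es eu.
apply: (iso_code (phi := u' \o phi \o s) ts cs tu cu).
- by apply: bij_comp => //; apply: bij_comp => //; exists u.
- by move=> i k; have [h1 _ _] := h (s i) (s k); rewrite /right_rel /= !u'u; exact: h1.
- by move=> i k; have [_ h1 _] := h (s i) (s k);
    rewrite /above_rel /xmeet /= !u'u; exact: h1.
by move=> i k; have [_ _ h1] := h (s i) (s k);
  rewrite /touch /vtouch /htouch /xmeet /ymeet /= !u'u; exact: h1.
Qed.

Lemma strong_equiv_refl r : strong_equiv r r.
Proof. by exists id; split=> //; exists id. Qed.

Lemma strong_equiv_sym r1 r2 : strong_equiv r1 r2 -> strong_equiv r2 r1.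
Proof.
case=> phi [[psi fg gf] h]; exists psi; split; first by exists phi.
by move=> i j; have [h1 h2 h3] := h (psi i) (psi j); rewrite !gf in h1 h2 h3; split;
  apply: iff_sym.
Qed.

Lemma strong_equiv_trans r1 r2 r3 :
  strong_equiv r1 r2 -> strong_equiv r2 r3 -> strong_equiv r1 r3.
Proof.
case=> phi [bphi h] [psi [bpsi k]]; exists (psi \o phi); split; first exact: bij_comp.
move=> i j; have [h1 h2 h3] := h i j; have [k1 k2 k3] := k (phi i) (phi j).
by split; [apply: iff_trans h1 k1|apply: iff_trans h2 k2|apply: iff_trans h3 k3].
Qed.

Lemma strong_class_eq r1 r2 : strong_class r1 = strong_class r2 <-> strong_equiv r1 r2.
Proof.
split=> [e|e].
  by have : strong_class r2 r2 := strong_equiv_refl r2; rewrite -e.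
apply/seteqP; split=> r h; last exact: strong_equiv_trans e h.
exact: strong_equiv_trans (strong_equiv_sym e) h.
Qed.

End Classes.

Lemma code_surjective (R : realType) n (e : {ffun 'I_n.+1 -> 'I_n.+1}) : admissible bad1 e ->
  exists2 r : rectangulation R n.+1, vertical_segments_reach_top r & has_code r e.
Proof.
move=> /word_valid v; case E : (state1 (word e)) => [[M b] w].
have [F [tF cF cE _ _]] := @realize R n _ _ _ _ (size_word e) v E.
have [r rF] := rectangulation_of ord0 tF.
exists r; first by apply/top_tiling_frame_of; rewrite rF.
exists id; rewrite rF; split; first by exists id.
  exact: cF.
by move=> j; rewrite -nth_word subSS -cE.
Qed.

(** The code is constant on strong classes and separates them, and every admissible sequence
    occurs. *)
Lemma Rs_top_card (R : realType) n (A : {set {ffun 'I_n.+1 -> 'I_n.+1}}) :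
  (forall e, e \in A <-> admissible bad1 e) -> (Rs_top R n.+1 #= `I_#|A|)%card.
Proof.
move=> AE.
pose P (C : set (rectangulation R n.+1)) e := exists r : rectangulation R n.+1,
  [/\ C = strong_class r, vertical_segments_reach_top r & has_code r e].
(* The default value is never taken on [Rs_top], where each class has a code. *)
pose g C := xget [ffun i => i] (P C).
have gP C : Rs_top R n.+1 C -> P C (g C) /\ g C \in A.
  case=> r rt <-; have [e ea ec] := code_exists rt.
  have Pg : P (strong_class r) (g (strong_class r)) by apply: (@xgetPex _ _ (P _)); exists e, r.
  split=> //; have [r' [re rt' c']] := Pg.
  have /strong_class_eq re' := re.
  by rewrite -(equiv_code rt rt' ec c' re'); apply/AE.
have ginj : {in Rs_top R n.+1 &, injective g}.
  move=> C D; rewrite !inE => /gP[[r [-> rt rc]] _] /gP[[r' [-> rt' rc']] _] e.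
  by apply/strong_class_eq; apply: code_equiv rt rt' rc _; rewrite e.
have im : (g @` Rs_top R n.+1 = [set` A])%classic.
  apply/seteqP; split=> [_ [C /gP[_ ?] <-] //|e /= /AE ea].
  have [r rt rc] := @code_surjective R _ _ ea.
  have rC : Rs_top R n.+1 (strong_class r) by exists r.
  exists (strong_class r) => //; have [[r' [re rt' rc']] _] := gP _ rC.
  by apply: equiv_code rt' rt rc' rc _; apply/strong_class_eq.
apply: card_eq_trans (_ : [set` A] #= _)%card; last first.
  have -> : ([set` A] = @enum_val _ (mem A) @` [set: 'I_#|A|])%classic.
    apply/seteqP; split=> [e /= eA|_ [i _ <-]]; last exact: enum_valP.
    by exists (enum_rank_in eA e) => //; exact: enum_rankK_in.
  apply: card_eq_trans (inj_card_eq _) _; first by move=> i k _ _; exact: enum_val_inj.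
  by rewrite card_eq_sym; apply: card_II.
by rewrite -im card_eq_sym; apply: inj_card_eq.
Qed.

Local Open Scope nat_scope.
Local Open Scope classical_set_scope.
Local Open Scope card_scope.

Theorem theorem4 (R : realType) (n : nat) :
  1 <= n ->
  [/\ Rs_top R n #=
        `I_#|inv_seqs n [:: [:: 0; 1; 0]; [:: 1; 0; 1]; [:: 1; 2; 0]; [:: 2; 0; 1]]|,
      #|inv_seqs n [:: [:: 0; 1; 0]; [:: 1; 0; 1]; [:: 1; 2; 0]; [:: 2; 0; 1]]| =
        #|inv_seqs n [:: [:: 0; 1; 0]; [:: 1; 1; 0]; [:: 1; 2; 0]; [:: 2; 1; 0]]|
    & #|inv_seqs n [:: [:: 0; 1; 0]; [:: 1; 1; 0]; [:: 1; 2; 0]; [:: 2; 1; 0]]| =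
        #|inv_seqs n [:: [:: 0; 1; 0]; [:: 1; 0; 0]; [:: 1; 2; 0]; [:: 2; 1; 0]]|].
Proof.
case: n => // n _; split; first exact/Rs_top_card/inv_seqs1.
  by rewrite (card_admissible (@inv_seqs1 _)) (card_admissible (@inv_seqs2 _)) size_avoiders1 size_avoiders2.
by rewrite (card_admissible (@inv_seqs2 _)) (card_admissible (@inv_seqs3 _)) size_avoiders2 size_avoiders3.
Qed.
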